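(* We have $h_3[h_0]=1$ and $h_3[h_1]=s_{3}$. Moreover, for every integer $n\ge 2$, with the convention that $h_3[h_m]=0$ whenever $m<0$, the following two identities hold: \[ (h_3[h_n])\downarrow_2 \;=\; s_{66}\odot\big((h_3[h_{n-4}])\downarrow_2\big) \;+\; \sum_{k=2}^{n} s_{3n-k,\,k} \;+\; s_{3n}, \] \[ h_3[h_n] \;=\; (h_3[h_n])\downarrow_2 \;+\; s_{222}\odot\big(h_3[h_{n-2}]\big) \;+\; s_{441}\odot\big((h_3[h_{n-3}])\downarrow_2\big). \]
   Context: Work in the ring $\Lambda$ of symmetric functions, with Schur basis $s_\mu$ indexed by integer partitions $\mu$ (with $s_{\emptyset}=s_0=1$); $h_n=s_{(n)}$ is the $n$-th complete homogeneous symmetric function, and $f[g]$ denotes the plethysm of symmetric functions. For a partition $\mu$, $\ell(\mu)$ is its number of nonzero parts. Two linear operators on $\Lambda$, defined on the Schur basis and extended (bi)linearly: (1) For $k\ge 1$, the projection $\downarrow_k$ is given by $s_\mu\downarrow_k = s_\mu$ if $\ell(\mu)\le k$ and $s_\mu\downarrow_k=0$ otherwise. (2) The bilinear operation $\odot$ is given by $s_\mu\odot s_\lambda = s_{\mu+\lambda}$, where $\mu+\lambda$ is the componentwise sum of the partitions (padding the shorter one with zero parts). For example $s_{66}\odot 1=s_{66}$ and $s_{441}\odot s_{3}=s_{741}$. Here $s_{66}, s_{222}, s_{441}$ denote the Schur functions indexed by the partitions $(6,6)$, $(2,2,2)$, $(4,4,1)$, and $s_{a,b}$ the one indexed by $(a,b)$.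 *)

(* Defs.v *)
From HB Require Import structures.
From mathcomp Require Import all_boot all_order all_algebra perm finmap.
From mathcomp Require Import zify ring.
From mathcomp Require Import monalg.
From Stdlib Require Import ClassicalEpsilon.

Set Implicit Arguments.
Unset Strict Implicit.
Unset Printing Implicit Defensive.

Import GRing.Theory Monoid.Theory.
Local Open Scope ring_scope.

(* Rational symmetric functions, as the polynomial ring QQ[p_1, p_2, ...] on
   the power sums; the variable with index i is p_(i+1). *)
Definition Lam : comAlgType rat := {malg rat[{cmonom nat}]}.

(* p_k, for k >= 1 only. *)
Definition psum (k : nat) : Lam := << ucm k.-1 >>.

Definition evm (S : comAlgType rat) (x : nat -> S) (m : {cmonom nat}) : S :=
  \prod_(i <- finsupp m) x i.+1 ^+ m i.

(* The QQ-algebra morphism sending p_k to x k for all k >= 1. *)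
Definition ev (S : comAlgType rat) (x : nat -> S) (f : Lam) : S :=
  mmap (in_alg S) (evm x) f.

(* p_k[g], the QQ-algebra morphism in g with p_k[p_m] = p_(k m). *)
Definition adams (k : nat) (g : Lam) : Lam := ev (fun m => psum (k * m)) g.

(* f[g], the QQ-algebra morphism in f sending p_k to p_k[g]. *)
Definition plethysm (f g : Lam) : Lam := ev (fun k => adams k g) f.

(* The sequence h_n, ..., h_1, h_0, by n h_n = p_1 h_(n-1) + ... + p_n h_0. *)
Fixpoint hsym_rev (n : nat) : seq Lam :=
  if n is n'.+1 then
    let s := hsym_rev n' in
    (n%:R^-1 *: \sum_(k < n) psum k.+1 * s`_k) :: s
  else [:: 1].

Definition hsym (n : nat) : Lam := (hsym_rev n)`_0.

(* det (h_(mu_i - i + j)), with h_m = 0 for m < 0; [schur_bialternant] below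
   identifies it with the quotient of alternants, in any number of variables. *)
Definition jacobi_trudi (n : nat) (mu : seq nat) : Lam :=
  \det (\matrix_(i < n, j < n)
    if (i <= nth 0%N mu i + j)%N then hsym (nth 0%N mu i + j - i) else 0).

Definition schur (mu : seq nat) : Lam := jacobi_trudi (size mu) mu.

Definition is_part (mu : seq nat) : bool := sorted geq mu && (0%N \notin mu).

Definition part : Type := {mu : seq nat | is_part mu}.
HB.instance Definition _ := Choice.on part.

Definition part_add (mu la : seq nat) : seq nat :=
  mkseq (fun i => nth 0 mu i + nth 0 la i)%N (maxn (size mu) (size la)).

Definition schur_comb (c : {malg rat[part]}) : Lam :=
  \sum_(mu <- msupp c) c@_mu *: schur (val mu).

(* The coordinates of f on the Schur basis; see [schur_combK] for uniqueness,
   and [down_schur], [odot_schur] for the operators on basis elements. *)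
Definition schur_coord (f : Lam) : {malg rat[part]} :=
  epsilon (inhabits 0) (fun c => schur_comb c = f).

Definition down (k : nat) (f : Lam) : Lam :=
  let c := schur_coord f in
  \sum_(mu <- msupp c | (size (val mu) <= k)%N) c@_mu *: schur (val mu).

Definition odot (f g : Lam) : Lam :=
  let c := schur_coord f in let d := schur_coord g in
  \sum_(mu <- msupp c) \sum_(la <- msupp d)
    (c@_mu * d@_la) *: schur (part_add (val mu) (val la)).

(* h_3[h_m], with the convention that it is 0 for m < 0. *)
Definition h3h (m : int) : Lam :=
  if m is Posz k then plethysm (hsym 3) (hsym k) else 0.

Lemma evm_mmorphism (S : comAlgType rat) (x : nat -> S) : mmorphism (evm x).
Proof.
have evmw (d : {fset nat}) (m : {cmonom nat}) : {subset finsupp m <= d} ->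
    evm x m = \prod_(i <- d) x i.+1 ^+ m i.
  move=> /fsubsetP le; rewrite /evm (big_fset_incl _ le) // => i _.
  by rewrite -cmE_eq0 => /eqP ->.
split=> [m1 m2|]; last by rewrite /evm mdom1 big_seq_fset0.
rewrite (evmw (finsupp m1 `|` finsupp m2)%fset m1); last first.
  by move=> i ?; rewrite inE; apply/orP; left.
rewrite (evmw (finsupp m1 `|` finsupp m2)%fset m2); last first.
  by move=> i ?; rewrite inE; apply/orP; right.
rewrite (evmw (finsupp m1 `|` finsupp m2)%fset); last by rewrite mdomD.
by rewrite -big_split; apply: eq_bigr => i _; rewrite cmM exprD.
Qed.

HB.instance Definition _ (S : comAlgType rat) (x : nat -> S) :=
  monalg.isMultiplicative.Build {cmonom nat} S (evm x) (evm_mmorphism x).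

Lemma ev_is_zmod_morphism (S : comAlgType rat) (x : nat -> S) :
  zmod_morphism (ev x).
Proof. exact: mmap_is_additive. Qed.

Lemma ev_is_monoid_morphism (S : comAlgType rat) (x : nat -> S) :
  monoid_morphism (ev x).
Proof. by have [? ?] := @mmap_is_multiplicative _ _ _ (in_alg S) (evm x). Qed.

HB.instance Definition _ (S : comAlgType rat) (x : nat -> S) :=
  GRing.isZmodMorphism.Build Lam S (ev x) (ev_is_zmod_morphism x).
HB.instance Definition _ (S : comAlgType rat) (x : nat -> S) :=
  GRing.isMonoidMorphism.Build Lam S (ev x) (ev_is_monoid_morphism x).

Lemma ev_scalable (S : comAlgType rat) (x : nat -> S) : scalable (ev x).
Proof. by move=> c f; rewrite /ev mmapZ /= -scalerAl mul1r. Qed.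

HB.instance Definition _ (S : comAlgType rat) (x : nat -> S) :=
  GRing.isScalable.Build rat Lam S *:%R (ev x) (ev_scalable x).

Lemma ev_psum (S : comAlgType rat) (x : nat -> S) k :
  (0 < k)%N -> ev x (psum k) = x k.
Proof.
case: k => // k _; rewrite /ev /psum mmapU /= scale1r mul1r /evm mdomU.
by rewrite big_seq_fset1 cmUU.
Qed.

Lemma nth_hsym_rev n k : (k <= n)%N -> (hsym_rev n)`_k = hsym (n - k).
Proof. by elim: n k => [|n IHn] [|k] //= /IHn; rewrite subSS. Qed.

Lemma hsym0 : hsym 0 = 1.
Proof. by []. Qed.

Lemma hsymS n :
  n.+1%:R *: hsym n.+1 = \sum_(k < n.+1) psum k.+1 * hsym (n - k).
Proof.
have -> : hsym n.+1 =
    n.+1%:R^-1 *: \sum_(k < n.+1) psum k.+1 * (hsym_rev n)`_k by [].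
rewrite scalerA mulfV ?Num.Theory.pnatr_eq0 // scale1r.
by apply: eq_bigr => k _; rewrite nth_hsym_rev // -ltnS.
Qed.

Lemma jacobi_trudiS n mu :
  (size mu <= n)%N -> jacobi_trudi n.+1 mu = jacobi_trudi n mu.
Proof.
move=> le_mu; rewrite /jacobi_trudi (expand_det_row _ ord_max).
rewrite big_ord_recr /= big1 => [|j _]; last first.
  by rewrite !mxE /= nth_default // add0n leqNgt ltn_ord mul0r.
rewrite !mxE /= nth_default // add0n leqnn subnn hsym0 mul1r add0r.
rewrite /cofactor -signr_odd oddD addbb expr0 mul1r; congr (\det _).
by apply/matrixP=> i j; rewrite !mxE !lift_max.
Qed.

Lemma schurE n mu : (size mu <= n)%N -> schur mu = jacobi_trudi n mu.
Proof.
rewrite /schur => /subnK <-; elim: (n - _)%N => [//|m ->].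
by rewrite addSn jacobi_trudiS // leq_addl.
Qed.

(* The image of a symmetric function in finitely many variables x_i. *)
Definition realize (S : comAlgType rat) (N : nat) (x : 'I_N -> S) : Lam -> S :=
  ev (fun k => \sum_(i < N) x i ^+ k).

HB.instance Definition _ (S : comAlgType rat) (N : nat) (x : 'I_N -> S) :=
  GRing.LRMorphism.copy (realize x) (ev (fun k => \sum_(i < N) x i ^+ k)).

(* a_(mu + delta) = det (x_j ^ (mu_i + N - i)), rows i counted from 1. *)
Definition alternant (S : comAlgType rat) (N : nat) (x : 'I_N -> S)
  (mu : seq nat) : S :=
  \det (\matrix_(i < N, j < N) x j ^+ (nth 0%N mu i + (N - i.+1))).

Section Bialternant.
Context (S : comAlgType rat) (N : nat) (x : 'I_N -> S).

Let lin (a : S) : {poly S} := 1 - a *: 'X.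
Let P (s : seq S) : {poly S} := \prod_(a <- s) lin a.
Let Q (M : nat) (s : seq S) : {poly S} :=
  \sum_(a <- s) \sum_(k < M) a ^+ k.+1 *: 'X^(k.+1).

Lemma logderiv M s : exists R, 'X * (P s)^`() + P s * Q M s = R * 'X^(M.+1).
Proof.
elim: s => [|a s [R IH]].
  by exists 0; rewrite /P /Q !big_nil derivC !mulr0 mul0r addr0.
exists (- (a ^+ M.+1)%:P * P s + lin a * R).
rewrite /P /Q !big_cons -/(P s) -/(Q M s) derivM.
have geo : 'X * (lin a)^`() + lin a * (\sum_(k < M) a ^+ k.+1 *: 'X^(k.+1))
    = - (a ^+ M.+1)%:P * 'X^(M.+1).
  rewrite /lin derivB derivC derivZ derivX sub0r -!mul_polyC.
  elim: M {R IH} => [|M IHM]; first by rewrite big_ord0 !expr1; ring.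
  rewrite big_ord_recr /= mulrDr addrA IHM -!mul_polyC.
  by rewrite !exprS !polyCM; ring.
rewrite [RHS]mulrDl -[lin a * R * _]mulrA -IH [X in _ = X + _]mulrAC -geo; ring.
Qed.

Let U M : {poly S} := \poly_(n < M) realize x (hsym n).
Let X := [seq x i | i <- enum 'I_N].

Lemma newton M n : (n <= M)%N ->
  ('X * (U M.+1)^`())`_n = (Q M X * U M.+1)`_n.
Proof.
move=> le_n; rewrite coefXM coefM.
have cQ k : (Q M X)`_k = if (0 < k <= M)%N then \sum_i x i ^+ k else 0.
  rewrite /Q /X big_map big_enum /= coef_sum.
  case: ifP => kM; last first.
    apply: big1 => i _; rewrite coef_sum big1 // => j _.
    by rewrite coefZ coefXn; case: eqP kM => [->|]; rewrite ?ltn_ord ?mulr0.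
  apply: eq_bigr => i _; rewrite coef_sum.
  have lt_k : (k.-1 < M)%N by lia.
  rewrite (bigD1 (Ordinal lt_k)) //= prednK; last by lia.
  rewrite coefZ coefXn eqxx mulr1 big1 ?addr0 // => j neq.
  rewrite coefZ coefXn; case: eqP; rewrite ?mulr0 // => kj.
  by case/eqP: neq; apply/val_inj; rewrite /= kj.
case: n le_n => [|n] le_n /=.
  by rewrite big_ord1 cQ mul0r.
rewrite big_ord_recl cQ mul0r add0r coef_deriv coef_poly ltnS le_n.
transitivity (realize x (n.+1%:R *: hsym n.+1)).
  by rewrite scaler_nat rmorphMn.
rewrite hsymS rmorph_sum; apply: eq_bigr => k _.
have lk := ltn_ord k.
rewrite rmorphM /= [realize x (psum _)]ev_psum // cQ /= coef_poly /bump /= add1n.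
by rewrite subSS ltnS !ifT //; lia.
Qed.

Lemma PU M n : (n <= M)%N -> (P X * U M.+1)`_n = (n == 0)%:R.
Proof.
case: n => [|n] le_n.
  rewrite coefM big_ord1 subn0 coef_poly hsym0 rmorph1 mulr1.
  rewrite -horner_coef0 /P horner_prod big1 // => a _.
  by rewrite !hornerE ?mulr0 ?subr0.
have [R HR] := logderiv M X.
have : ('X * (P X * U M.+1)^`())`_n.+1 = 0.
  have -> : 'X * (P X * U M.+1)^`() = ('X * (P X)^`()) * U M.+1
     + P X * ('X * (U M.+1)^`()) by rewrite derivM; ring.
  rewrite (_ : 'X * (P X)^`() = R * 'X^(M.+1) - P X * Q M X); last first.
    by rewrite -HR addrK.
  have -> : (R * 'X^(M.+1) - P X * Q M X) * U M.+1 =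
     R * U M.+1 * 'X^(M.+1) - P X * (Q M X * U M.+1) by ring.
  rewrite coefD coefB coefMXn ltnS le_n sub0r.
  rewrite [in X in - X]coefM [in X in _ + X]coefM.
  apply/eqP; rewrite addrC subr_eq0; apply/eqP; apply: eq_bigr => k _.
  by rewrite newton //; lia.
rewrite coefXM /= coef_deriv => /(congr1 ( *:%R (n.+1%:R^-1 : rat))).
rewrite -scaler_nat scalerA mulVf ?Num.Theory.pnatr_eq0 //.
by rewrite scale1r scaler0.
Qed.

Let E (j : 'I_N) : {poly S} := \prod_(l < N | l != j) lin (x l).

Lemma EU j M n : (n <= M)%N -> (E j * U M.+1)`_n = x j ^+ n.
Proof.
move=> le_n.
have PE : P X = lin (x j) * E j.
  by rewrite /P /X big_map big_enum /= (bigD1 j).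
elim: n le_n => [|n IHn] le_n; have := PU le_n; rewrite PE -mulrA mulrBl mul1r.
all: by rewrite coefB -scalerAl coefZ coefXM /= => /eqP;
  rewrite ?mulr0 ?subr0 ?subr_eq0 => /eqP -> //; rewrite ?IHn ?exprS // ltnW.
Qed.

Lemma size_E j : (size (E j) <= N)%N.
Proof.
have sz a : (size (lin a) <= 2)%N.
  apply: leq_trans (size_polyD _ _) _; rewrite size_poly1 size_polyN geq_max /=.
  by apply: leq_trans (size_scale_leq _ _) _; rewrite size_polyX.
apply: leq_trans (size_prod_leq _ _) _.
have le2 : (\sum_(l < N | l != j) size (lin (x l)) <= #|predC1 j| * 2)%N.
  by rewrite -sum_nat_const; apply: leq_sum.
have := cardC1 j; rewrite card_ord => c1.
have jN := ltn_ord j.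
rewrite (eq_card (B := predC1 j)) // c1; move: le2; rewrite c1.
move: (\sum_(l < N | _) _)%N => b; lia.
Qed.

Let Emx := \matrix_(l < N, j < N) (E j)`_(N - l.+1).

Lemma JT_E mu : \det (\matrix_(i < N, j < N) realize x
    (if (i <= nth 0%N mu i + j)%N then hsym (nth 0%N mu i + j - i) else 0))
    * \det Emx = alternant x mu.
Proof.
rewrite -det_mulmx /alternant; congr (\det _); apply/matrixP=> i j.
rewrite !mxE; set a := nth _ _ _.
have lti := ltn_ord i.
rewrite -(EU j (leqnn (a + (N - i.+1)))) coefM.
rewrite (reindex_inj rev_ord_inj) /=.
pose F k : S := (E j)`_k *
  (if (k <= a + (N - i.+1))%N then realize x (hsym (a + (N - i.+1) - k)) else 0).
transitivity (\sum_(k < N) F k).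
  apply: eq_bigr => k _; rewrite !mxE /= mulrC /F; have ltk := ltn_ord k.
  have -> : (N - (N - k.+1).+1 = k)%N by lia.
  have -> : (i <= a + (N - k.+1))%N = (k <= a + (N - i.+1))%N by lia.
  case: ifP => le; last by rewrite rmorph0.
  by congr (_ * realize x (hsym _)); lia.
transitivity (\sum_(k < (a + (N - i.+1)).+1) F k); last first.
  apply: eq_bigr => k _; rewrite /F -ltnS ltn_ord coef_poly ifT //.
  have := ltn_ord k; lia.
rewrite -!(big_mkord xpredT F).
have F0 k : (N <= k)%N || (a + (N - i.+1) < k)%N -> F k = 0.
  rewrite /F; case/orP => lek; last by rewrite leqNgt lek mulr0.
  by rewrite nth_default ?mul0r //; apply: leq_trans (size_E j) lek.
set b := (a + (N - i.+1)).+1.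
case: (leqP N b) => Nb.
  rewrite [RHS](big_cat_nat (n := N)) //= [X in _ + X]big_nat_cond [X in _ + X]big1 ?addr0 //.
  by move=> k; rewrite andbT => /andP[lek _]; rewrite F0 ?lek.
rewrite (big_cat_nat (n := b)) //=; last exact: ltnW.
rewrite [X in _ + X]big_nat_cond [X in _ + X]big1 ?addr0 //.
by move=> k; rewrite andbT => /andP[lek _]; rewrite F0 ?lek ?orbT.
Qed.

Lemma schur_bialternant mu : (size mu <= N)%N ->
  alternant x [::] * realize x (schur mu) = alternant x mu.
Proof.
move=> le_mu; rewrite (schurE le_mu) /jacobi_trudi -det_map_mx.
rewrite -(JT_E mu) mulrC; congr (_ * _).
  by congr (\det _); apply/matrixP => i j; rewrite !mxE.
rewrite -(JT_E [::]) (_ : \det _ = 1) ?mul1r //.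
rewrite -det_tr det_trig; last first.
  apply/is_trig_mxP => i j ij; rewrite !mxE nth_nil add0n leqNgt ij /=.
  exact: rmorph0.
by apply: big1 => i _; rewrite !mxE nth_nil add0n leqnn subnn hsym0 rmorph1.
Qed.
End Bialternant.

Section Independence.
Context (N : nat).

Let poln : comAlgType rat := {malg rat[{cmonom 'I_N}]}.
Let var (i : 'I_N) : poln := << ucm i >>.

Let mon (b : 'I_N -> nat) : {cmonom 'I_N} :=
  \big[mmul/mone]_(j < N) iter (b j) (mmul (ucm j)) mone.

Lemma monE b i : mon b i = b i.
Proof.
have iterE n j : iter n (mmul (ucm j)) mone i = (n * (j == i))%N.
  elim: n => [|n IHn]; first by rewrite cm1.
  by rewrite iterS cmM IHn cmU mulSn.
rewrite /mon (big_morph (fun m : {cmonom 'I_N} => m i) (cmM i) (cm1 i)).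
rewrite (bigD1 i) //= iterE eqxx muln1 big1 ?addn0 // => j /negbTE ji.
by rewrite iterE ji muln0.
Qed.

Lemma prod_var b : \prod_(j < N) var j ^+ b j = << mon b >>.
Proof.
have UM (m1 m2 : {cmonom 'I_N}) :
    << mmul m1 m2 >> = << m1 >> * << m2 >> :> poln.
  by rewrite malgM_def fgmulUU mulr1.
rewrite /mon (big_morph (fun m => << m >> : poln) UM (erefl (1 : poln))).
apply: eq_bigr => j _; elim: (b j) => [|n IHn]; first by rewrite expr0.
by rewrite exprS IHn /= UM.
Qed.

Let alpha (mu : seq nat) (i : 'I_N) : nat := (nth 0 mu i + (N - i.+1))%N.

Lemma alternant_var mu :
  alternant var mu = \sum_(s : 'S_N) (-1) ^+ s *: << mon (alpha mu \o s) >>.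
Proof.
rewrite /alternant -det_tr /determinant; apply: eq_bigr => s _.
rewrite -prod_var scaler_sign -signr_odd oddb mulr_sign; congr (if _ then _ else _).
  by congr (- _); apply: eq_bigr => i _; rewrite !mxE.
by apply: eq_bigr => i _; rewrite !mxE.
Qed.

Lemma part_nth_le mu i j : is_part mu -> (i <= j)%N ->
  (nth 0 mu j <= nth 0 mu i)%N.
Proof.
case/andP=> smu _ ij; case: (ltnP j (size mu)) => jmu; last first.
  by rewrite nth_default.
have tr : transitive geq by move=> a b c ba ac; apply: leq_trans ac ba.
apply: (sorted_leq_nth tr leqnn 0%N smu) => //; exact: leq_ltn_trans ij jmu.
Qed.

Lemma part_ext mu nu : is_part mu -> is_part nu -> (size mu <= N)%N ->
  (size nu <= N)%N -> alpha mu =1 alpha nu -> mu = nu.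
Proof.
move=> pmu pnu smu snu eqa.
have eqn i : nth 0%N mu i = nth 0%N nu i.
  case: (ltnP i N) => iN; first by have := eqa (Ordinal iN); rewrite /alpha /=; lia.
  by rewrite !nth_default // (leq_trans _ iN).
have pos (la : seq nat) i : is_part la -> (nth 0%N la i != 0%N) = (i < size la)%N.
  case/andP=> _ nz; case: ltnP => ila; last by rewrite nth_default.
  by apply: contra nz => /eqP <-; apply: mem_nth.
apply: (eq_from_nth (x0 := 0%N)) => // ; apply/eqP.
case: ltngtP => //.
  by rewrite -(pos nu _ pnu) -eqn nth_default.
by rewrite -(pos mu _ pmu) eqn nth_default.
Qed.

Lemma alpha_perm mu nu (s : 'S_N) : is_part mu -> is_part nu ->
  alpha nu \o s =1 alpha mu -> alpha nu =1 alpha mu /\ s = 1%g.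
Proof.
move=> pmu pnu eqs.
have dec la (i j : 'I_N) : is_part la -> (i < j)%N -> (alpha la j < alpha la i)%N.
  move=> pla ij; have := part_nth_le pla (ltnW ij); rewrite /alpha.
  have := ltn_ord j; lia.
have s1 : s = 1%g.
  have mono (i j : 'I_N) : (i < j)%N -> (s i < s j)%N.
    move=> ij; have := dec _ _ _ pmu ij; rewrite -!eqs /=.
    case: (ltngtP (s i) (s j)) => // [lt|/val_inj ->]; last by rewrite ltnn.
    by have := dec _ _ _ pnu lt; lia.
  have ge i : forall j : 'I_N, j = i :> nat -> (i <= s j)%N.
    elim: i => // i IHi j ji.
    have iN : (i < N)%N by have := ltn_ord j; lia.
    have := IHi (Ordinal iN) erefl.
    have : (s (Ordinal iN) < s j)%N by apply: mono; rewrite /= ji.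
    lia.
  have sum_eq : (\sum_(i < N) (s i - i) = 0)%N.
    rewrite sumnB => [|i _]; last exact: ge.
    by rewrite [X in (_ - X)%N](reindex_perm s) /= subnn.
  apply/permP => i; rewrite perm1; apply/val_inj/eqP => /=.
  move/eqP: sum_eq; rewrite sum_nat_eq0 => /forallP /(_ i) /= /eqP.
  have := ge _ i erefl; rewrite eqn_leq; lia.
by split=> // i; have := eqs i; rewrite s1 /= perm1.
Qed.

Lemma alternant_coef mu nu : is_part mu -> is_part nu -> (size mu <= N)%N ->
  (size nu <= N)%N -> (alternant var mu)@_(mon (alpha nu)) = (mu == nu)%:R.
Proof.
move=> pmu pnu smu snu; rewrite alternant_var.
have coefE (t : 'S_N) m k :
    ((-1) ^+ t *: << m >> : poln)@_k = (-1) ^+ t * (m == k)%:R.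
  by rewrite mcoeffZ mcoeffU1.
have monP b c : (mon b == mon c) = [forall i, b i == c i].
  apply/cmP/forallP => H i; last by rewrite !monE; apply/eqP.
  by apply/eqP; have := H i; rewrite !monE.
rewrite (_ : _@__ = \sum_(s : 'S_N)
    (-1) ^+ s * (mon (alpha mu \o s) == mon (alpha nu))%:R); last first.
  by rewrite raddf_sum; apply: eq_bigr => s _; exact: coefE.
case: (mu =P nu) => [->|neq].
  rewrite (bigD1 (1%g : 'S_N) isT) odd_perm1 expr0 mul1r.
  rewrite monP (_ : [forall i, _]); last first.
    by apply/forallP => i; rewrite /= perm1.
  rewrite big1 ?addr0 // => s /negP s1; rewrite monP.
  case: forallP => H; last by rewrite mulr0.
  case: s1; apply/eqP; have [] // := @alpha_perm nu nu s pnu pnu.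
  by move=> i; apply/eqP/H.
apply: big1 => s _; rewrite monP.
case: forallP => H; last by rewrite mulr0.
case: neq; apply: part_ext => //.
by have [] // := @alpha_perm nu mu s pnu pmu (fun i => eqP (H i)).
Qed.

Lemma comb_coef (c : {malg rat[part]}) (nu : part) :
  (forall mu : part, mu \in msupp c -> (size (val mu) <= N)%N) ->
  (size (val nu) <= N)%N ->
  (alternant var [::] * realize var (schur_comb c))@_(mon (alpha (val nu)))
  = c@_nu.
Proof.
move=> sc snu; rewrite /schur_comb.
rewrite (raddf_sum (realize var)) mulr_sumr raddf_sum.
transitivity (\sum_(mu <- msupp c) c@_mu * (mu == nu)%:R).
  rewrite big_seq [RHS]big_seq; apply: eq_bigr => mu /sc smu.
  rewrite -(alternant_coef (valP mu) (valP nu) smu snu).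
  rewrite -(schur_bialternant var smu) -mcoeffZ scalerAr.
  by rewrite -[in RHS]ev_scalable.
have := mcoeff_eq0 c nu; case: (boolP (nu \in msupp c)) => nuc.
  move=> _; rewrite (big_fsetD1 nu) //= eqxx mulr1 big_seq_cond big1 ?addr0 //.
  move=> mu; rewrite andbT !inE => /andP [/negbTE -> _].
  by rewrite mulr0.
move/eqP => ->; rewrite big_seq_cond big1 // => mu; rewrite andbT => muc.
by case: eqP nuc => [<-|]; rewrite ?muc ?mulr0.
Qed.
End Independence.

Lemma schur_comb_inj : injective schur_comb.
Proof.
move=> c d eqcd; apply/malgP => nu.
pose B (e : {malg rat[part]}) := (\max_(mu <- msupp e) size (val mu))%N.
pose N := (size (val nu) + B c + B d)%N.
have BP (e : {malg rat[part]}) (mu : part) :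
    mu \in msupp e -> (size (val mu) <= B e)%N.
  by move=> mue; rewrite /B (big_rem mu mue) /= leq_max leqnn.
have snu : (size (val nu) <= N)%N by rewrite /N -addnA leq_addr.
have cE : _ = c@_nu := comb_coef (N := N) (c := c) _ snu.
have dE : _ = d@_nu := comb_coef (N := N) (c := d) _ snu.
rewrite -cE => [|mu /BP]; last by rewrite /N; lia.
rewrite -dE => [|mu /BP]; last by rewrite /N; lia.
by rewrite eqcd.
Qed.

Lemma schur_combK : cancel schur_comb schur_coord.
Proof.
move=> c; apply: schur_comb_inj; rewrite /schur_coord.
by apply: (epsilon_spec (inhabits 0) (fun d => schur_comb d = schur_comb c));
  exists c.
Qed.

Lemma schur_combU (mu : part) : schur_comb << mu >> = schur (val mu).
Proof.
rewrite /schur_comb msuppU oner_eq0 big_seq_fset1.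
by rewrite mcoeffUU scale1r.
Qed.

Lemma schur_coord_schur (mu : part) : schur_coord (schur (val mu)) = << mu >>.
Proof. by rewrite -schur_combU schur_combK. Qed.

Lemma down_schur (k : nat) (mu : part) :
  down k (schur (val mu)) =
    if (size (val mu) <= k)%N then schur (val mu) else 0.
Proof.
rewrite /down schur_coord_schur msuppU oner_eq0 big_mkcond.
by rewrite big_seq_fset1 mcoeffUU scale1r.
Qed.

Lemma odot_schur (mu la : part) :
  odot (schur (val mu)) (schur (val la)) = schur (part_add (val mu) (val la)).
Proof.
rewrite /odot (schur_coord_schur mu) (schur_coord_schur la) !msuppU oner_eq0.
by rewrite !big_seq_fset1 !mcoeffUU mulr1 scale1r.
Qed.

(* Main.v *)
Require Import Defs.
From HB Require Import structures.
From mathcomp Require Import all_boot all_order all_algebra finmap.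
From mathcomp Require Import zify ring.
From mathcomp Require Import monalg.
From mathcomp Require mpoly.

(** Newton's identities give [6 h_3[g] = g^3 + 3 g p_2[g] + 2 p_3[g]], and the
    factorisations [p_2[H](t^2) = H(t) H(-t)] and
    [p_3[H](t^3) = H(t) H(omega t) H(omega^2 t)] of the generating function [H]
    of the [h_n] show that [h_3[h_n]] is a combination of products of three
    [h_i], hence of Schur functions with at most three rows. Such combinations are
    determined by their values in three variables [x], [y], [z]. There
    [s_222 odot] is multiplication by [(x y z)^2]; dropping the Schur functions
    with three rows amounts to setting [z = 0], and in two variables [s_66 odot]
    is multiplication by [(x y)^6]. Since [h_n] is an explicit rational function
    of the variables and of their [n]-th powers, both recursions become
    identities between rational functions in which the [n]-th powers are
    independent indeterminates. *)

Set Implicit Arguments.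
Unset Strict Implicit.
Unset Printing Implicit Defensive.

Import GRing.Theory.
Local Open Scope ring_scope.

(** * Newton's recursion for the images of the complete functions *)

Section Evaluation.
Context (S : comAlgType rat).
Implicit Types x y z : nat -> S.

Lemma eq_ev x y f : (forall k, (0 < k)%N -> x k = y k) -> ev x f = ev y f.
Proof.
move=> xy; rewrite /ev !mmapE; apply: eq_bigr => m _; congr (_ * _).
by apply: eq_bigr => i _; rewrite xy.
Qed.

Lemma rmorph_ev (S' : comAlgType rat) (phi : {lrmorphism S -> S'}) x f :
  phi (ev x f) = ev (phi \o x) f.
Proof.
rewrite /ev !mmapE rmorph_sum; apply: eq_bigr => m _.
rewrite rmorphM /= rmorph_alg; congr (_ * _).
by rewrite /evm rmorph_prod; apply: eq_bigr => i _; rewrite rmorphXn.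
Qed.

Lemma ev_hsymS x n :
  n.+1%:R *: ev x (hsym n.+1) =
  \sum_(0 <= k < n.+1) x k.+1 * ev x (hsym (n - k)).
Proof.
rewrite -linearZ /= hsymS rmorph_sum big_mkord; apply: eq_bigr => k _.
by rewrite rmorphM /= ev_psum.
Qed.

Lemma scale_natSI n : injective (fun a : S => n.+1%:R *: a :> S).
Proof.
move=> a b /(congr1 (fun c => (n.+1%:R^-1 : rat) *: c)).
by rewrite !scalerA mulVf ?Num.Theory.pnatr_eq0 // !scale1r.
Qed.

(** As [n + 1] is invertible in a QQ-algebra, Newton's recursion determines the whole sequence. Each
    generating-function identity below is proved by checking this recursion. *)
Lemma ev_hsym_unique x (u : nat -> S) : u 0%N = 1 ->
  (forall n, n.+1%:R *: u n.+1 = \sum_(0 <= k < n.+1) x k.+1 * u (n - k)%N) ->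
  forall n, u n = ev x (hsym n).
Proof.
move=> u0 uS; elim/ltn_ind=> [[|n] IHn]; first by rewrite u0 hsym0 rmorph1.
apply: (@scale_natSI n); rewrite uS ev_hsymS.
by apply: eq_big_nat => k /andP[_ kn]; rewrite IHn // ltnS leq_subr.
Qed.

(** Both sides run over the triples of sum [n - 1]: the left groups them by the sum of the first two
    entries, the right by the first entry. *)
Lemma sum_triangle (F : nat -> nat -> nat -> S) n :
  \sum_(0 <= b < n.+1) \sum_(0 <= k < b) F k (b.-1 - k)%N (n - b)%N =
  \sum_(0 <= k < n) \sum_(0 <= b < n - k) F k b (n.-1 - k - b)%N.
Proof.
rewrite big_nat_recl // [X in X + _]big_geq // add0r.
under eq_big_nat => i ltin.
  rewrite (big_nat_widen _ _ n) //.
  over.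
rewrite (exchange_big_dep_nat xpredT) //=.
apply: eq_big_nat => k /andP[_ kn].
rewrite (big_cat_nat (n := k)) //=; last exact: ltnW.
rewrite big_nat_cond big_pred0 ?add0r; last by move=> i; lia.
rewrite -{1}[k]add0n big_addn big_nat_cond [RHS]big_nat_cond.
by apply: eq_big => [i|i _]; [lia | congr F; lia].
Qed.

(* The hypothesis on the weight [w] is what turns the Newton recursions of [x]
   and [y] into that of [z]. *)
Lemma ev_hsym_convolution (w : nat -> nat -> rat) x y z :
  w 0%N 0%N = 1 ->
  (forall b c k, (0 < k)%N ->
     w (b + k)%N c *: x k + w b (c + k)%N *: y k = w b c *: z k) ->
  forall n, ev z (hsym n) =
    \sum_(0 <= b < n.+1) w b (n - b)%N *: (ev x (hsym b) * ev y (hsym (n - b))).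
Proof.
move=> w0 wS n; symmetry; move: n; apply: ev_hsym_unique.
  by rewrite big_nat1 w0 !subn0 hsym0 !rmorph1 mulr1 scale1r.
move=> n; rewrite scaler_sumr.
pose Fx k b c := w (b + k.+1)%N c *: (x k.+1 * ev x (hsym b) * ev y (hsym c)).
pose Fy k c b := w b (c + k.+1)%N *: (y k.+1 * ev x (hsym b) * ev y (hsym c)).
transitivity
  (\sum_(0 <= b < n.+2) \sum_(0 <= k < b) Fx k (b.-1 - k)%N (n.+1 - b)%N +
   \sum_(0 <= b < n.+2) \sum_(0 <= k < b) Fy k (b.-1 - k)%N (n.+1 - b)%N).
  rewrite [X in _ + X]big_nat_rev /= -big_split; apply: eq_big_nat => b bn.
  rewrite add0n subSS; have -> : (n.+1 - (n.+1 - b) = b)%N by lia.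
  rewrite scalerA mulrC -scalerA.
  (* As in the Leibniz rule for [t d/dt], the part [b] of the degree goes to Newton's recursion for
     [x] and the part [n + 1 - b] to that for [y]. *)
  have -> : (n.+1%:R : rat) = b%:R + (n.+1 - b)%:R.
    by rewrite -natrD; congr _%:R; lia.
  rewrite scalerDl scalerDr; congr (_ + _).
    case: b bn => [|b] bn; first by rewrite scale0r scaler0 big_geq.
    rewrite scalerAl ev_hsymS mulr_suml scaler_sumr.
    apply: eq_big_nat => k kb; rewrite /Fx /=.
    by congr (w _ _ *: _); lia.
  case: (n.+1 - b)%N => [|c]; first by rewrite scale0r scaler0 big_geq.
  rewrite scalerAr ev_hsymS mulr_sumr scaler_sumr.
  apply: eq_big_nat => k kb; rewrite /Fy /= mulrA [ev _ _ * _]mulrC.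
  by congr (w _ _ *: _); lia.
rewrite !sum_triangle -big_split; apply: eq_big_nat => k kn /=.
rewrite [X in _ + X]big_nat_rev -big_split mulr_sumr.
have -> : (n.+1 - k = (n - k).+1)%N by lia.
apply: eq_big_nat => b bn; rewrite /Fx /Fy add0n subSS.
have -> : (n - k - (n - k - b) = b)%N by lia.
rewrite /= -!mulrA !scalerAl -mulrDl wS //.
by rewrite -!scalerAl scalerAr.
Qed.

End Evaluation.

(** * The plethysms of [p_2], [p_3] and [h_3] with [h_n] *)

HB.instance Definition _ r := GRing.LRMorphism.copy (adams r)
  (ev (fun m => psum (r * m))).
Lemma ev_psum_hsym n : ev psum (hsym n) = hsym n.
Proof.
apply/esym; move: n; apply: ev_hsym_unique => // n.
by rewrite hsymS big_mkord.
Qed.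

Lemma adams1_hsym n : adams 1 (hsym n) = hsym n.
Proof. by rewrite -[RHS]ev_psum_hsym; apply: eq_ev => k _; rewrite mul1n. Qed.

(** The evaluation on the right belongs to the alphabet multiplied by all [r]-th roots of unity,
    whose power sums are [r p_k] for [r | k] and 0 otherwise. The claim is thus the degree [n r]
    part of the factorisation of [p_r[H](t^r)] into the [H(zeta t)] with [zeta^r = 1]. *)
Lemma adams_hsym r n : (0 < r)%N ->
  adams r (hsym n) =
  ev (fun k => if (r %| k)%N then r%:R *: psum k else 0) (hsym (n * r)).
Proof.
move=> r_gt0; rewrite -(prednK r_gt0); move: r.-1 => {r_gt0} r.
pose x k := if (r.+1 %| k)%N then r.+1%:R *: psum k else 0; rewrite -/x.
(* Newton's recursion passes through all degrees, so the candidate sequence is extended by 0 off the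
   multiples of [r + 1]. *)
pose u m := if (r.+1 %| m)%N then adams r.+1 (hsym (m %/ r.+1)) else 0.
have u0 : u 0%N = 1 by rewrite /u dvdn0 div0n hsym0 rmorph1.
rewrite -(@ev_hsym_unique _ x u u0); first by rewrite /u dvdn_mull ?mulnK.
move=> m; rewrite {1}/u.
case: (boolP (r.+1 %| m.+1)%N) => [/dvdnP[q Dm]|ndm]; last first.
  rewrite scaler0 big_nat_cond big1 // => k /andP[/andP[_ km] _].
  rewrite /x; case: ifP => dk; last by rewrite mul0r.
  rewrite /u; case: ifP => dmk; last by rewrite mulr0.
  have := dvdn_add dmk dk; have -> : (m - k + k.+1 = m.+1)%N by lia.
  by rewrite (negbTE ndm).
case: q Dm => [|q] Dm; first by move: Dm; rewrite mul0n.
rewrite Dm mulnK // natrM mulrC -scalerA ev_hsymS big_nat_mul scaler_sumr.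
apply: eq_big_nat => j jq.
(* In each block of [r + 1] consecutive indices only the last one contributes, because [x k.+1]
   vanishes unless [r + 1] divides [k + 1]. *)
rewrite [(j.+1 * _)%N]mulSn addSn [(r + _)%N]addnC big_nat_recr ?leq_addr //=.
rewrite big_nat_cond big1 ?add0r => [|k /andP[/andP[jk kj] _]].
  rewrite /x (_ : (_ + r).+1 = (j.+1 * r.+1)%N); last by lia.
  rewrite /u dvdn_mull // (_ : (m - _)%N = ((q - j) * r.+1)%N); last first.
    by rewrite mulnBl; lia.
  by rewrite dvdn_mull // mulnK // scalerAl mulnC.
rewrite /x; case: ifP => [/dvdnP[i Di]|]; last by rewrite mul0r.
by have : (j < i < j.+1)%N; [apply/andP; split; nia | lia].
Qed.

Lemma adams2_hsym n : adams 2 (hsym n) =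
  \sum_(0 <= b < (n * 2).+1) (-1) ^+ b *: (hsym b * hsym (n * 2 - b)).
Proof.
rewrite (adams_hsym _ (isT : 0 < 2)%N); set z := fun k => _.
(* This weight turns the first factor into [H(-t)], with power sums [(-1)^k p_k]; adding [p_k]
   doubles the even ones and kills the odd ones. *)
pose w b (_ : nat) : rat := (-1) ^+ b.
have wS b c k : (0 < k)%N ->
    w (b + k)%N c *: psum k + w b (c + k)%N *: psum k = w b c *: z k.
  move=> _; rewrite /z /w exprD -scalerDl -[(-1) ^+ k]signr_odd dvdn2.
  case: (odd k); first by rewrite /= mulrN1 addNr scale0r scaler0.
  by rewrite /= expr0 mulr1 [RHS]scalerA mulr_natr mulr2n.
rewrite (ev_hsym_convolution (erefl : w 0%N 0%N = 1) wS).
by apply: eq_bigr => b _; rewrite !ev_psum_hsym.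
Qed.

(* [w b c] is the real part of [omega ^ (b - c)], for [omega] a primitive cube
   root of unity: the identity is the coefficient extraction in
   [p_3[H](t^3) = H(t) H(omega t) H(omega^2 t)]. *)
Lemma adams3_hsym n : exists w : nat -> nat -> rat, adams 3 (hsym n) =
  \sum_(0 <= a < (n * 3).+1) \sum_(0 <= b < (n * 3 - a).+1)
    w b (n * 3 - a - b)%N *: (hsym a * hsym b * hsym (n * 3 - a - b)).
Proof.
pose w b c : rat := if b == c %[mod 3] then 1 else - 2%:R^-1; exists w.
(* These are the power sums belonging to [H(omega t) H(omega^2 t)], since [omega^k + omega^(2k)] is
   2 when 3 divides [k] and -1 otherwise. A second convolution, of weight 1, brings in the factor
   [H(t)]. *)
pose y k : Lam := (if (3 %| k)%N then 2%:R else -1 : rat) *: psum k.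
have wS b c k : (0 < k)%N ->
    w (b + k)%N c *: psum k + w b (c + k)%N *: psum k = w b c *: y k.
  move=> _; rewrite /y -scalerDl scalerA.
  apply: (congr1 (fun q : rat => q *: psum k)); rewrite /w.
  by case: ifP => ?; case: ifP => ?; case: ifP => ?; case: ifP => ?;
    first [by exfalso; lia | field].
rewrite (adams_hsym _ (isT : 0 < 3)%N); set z := fun k => _.
have yS (b c k : nat) : (0 < k)%N ->
    (1 : rat) *: psum k + (1 : rat) *: y k = (1 : rat) *: z k.
  move=> _; rewrite /y /z !scale1r; case: ifP => _.
    by rewrite -[X in X + _]scale1r -scalerDl nat1r.
  by rewrite scaleN1r subrr.
rewrite (@ev_hsym_convolution _ (fun _ _ => 1) _ _ _ erefl yS).
apply: eq_bigr => a _; rewrite scale1r ev_psum_hsym.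
rewrite (ev_hsym_convolution (erefl : w 0%N 0%N = 1) wS) mulr_sumr.
by apply: eq_bigr => b _; rewrite !ev_psum_hsym -scalerAr mulrA.
Qed.

Lemma newton3 (S : comAlgType rat) (x u : nat -> S) : u 0%N = 1 ->
  (forall n, n.+1%:R *: u n.+1 = \sum_(0 <= k < n.+1) x k.+1 * u (n - k)%N) ->
  u 3 *+ 6 = x 1%N ^+ 3 + x 1%N * x 2 *+ 3 + x 3 *+ 2.
Proof.
move=> u0 uS; have := uS 0%N; have := uS 1%N; have := uS 2.
rewrite !big_nat_recr //= !big_geq // !add0r !scaler_nat mulr1n.
rewrite !(subn0, subnn, subSS) u0 !mulr1 => u3 u2 u1.
rewrite (mulrnA _ 3 2) u3 u1 !mulrnDl -[x 1%N * u 2 *+ 2]mulrnAr u2 u1; ring.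
Qed.

Lemma ev_hsym3 (S : comAlgType rat) (x : nat -> S) :
  ev x (hsym 3) *+ 6 = x 1%N ^+ 3 + x 1%N * x 2 *+ 3 + x 3 *+ 2.
Proof.
apply: (newton3 (u := fun n => ev x (hsym n))); first by rewrite hsym0 rmorph1.
exact: ev_hsymS.
Qed.

Lemma plethysm_h3_hsym n : plethysm (hsym 3) (hsym n) *+ 6 =
  hsym n ^+ 3 + hsym n * adams 2 (hsym n) *+ 3 + adams 3 (hsym n) *+ 2.
Proof.
apply: etrans (ev_hsym3 (fun k => adams k (hsym n))) _.
exact: (congr1 (fun a => a ^+ 3 + a * adams 2 (hsym n) *+ 3
  + adams 3 (hsym n) *+ 2) (adams1_hsym n)).
Qed.

(** * Combinations of Schur functions with a bounded number of rows *)

Lemma schur_combE c :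
  schur_comb c = mmap (in_alg Lam) (fun mu : part => schur (val mu)) c.
Proof. by rewrite mmapE; apply: eq_bigr => mu _; rewrite /= mulr_algl. Qed.

Lemma schur_combD c d : schur_comb (c + d) = schur_comb c + schur_comb d.
Proof. by rewrite !schur_combE mmapD. Qed.

Lemma schur_combZ a c : schur_comb (a *: c) = a *: schur_comb c.
Proof.
rewrite !schur_combE (mmapEw (msuppZ_le _ _)) mmapE scaler_sumr.
apply: eq_bigr => mu _; rewrite mcoeffZ.
by rewrite [LHS]mulr_algl [in RHS]mulr_algl scalerA.
Qed.

Lemma schur_comb0 : schur_comb 0 = 0.
Proof. by rewrite schur_combE mmap0. Qed.

(** The operators are defined through coordinates, so the combination itself is kept as the witness;
    [schur_combK] identifies it with the coordinates of [f]. *)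
Definition rows_le (k : nat) (f : Lam) : Prop :=
  exists2 c, schur_comb c = f &
    forall mu : part, mu \in msupp c -> (size (val mu) <= k)%N.

Section RowsLe.
Context (k : nat).
Implicit Types f g : Lam.

Lemma rows_le0 : rows_le k 0.
Proof. by exists 0; [exact: schur_comb0 | move=> mu; rewrite msupp0]. Qed.

Lemma rows_leD f g : rows_le k f -> rows_le k g -> rows_le k (f + g).
Proof.
move=> [c <- ck] [d <- dk]; exists (c + d); first exact: schur_combD.
by move=> mu /(fsubsetP (msuppD_le _ _)); rewrite inE => /orP[/ck|/dk].
Qed.

Lemma rows_leZ a f : rows_le k f -> rows_le k (a *: f).
Proof.
move=> [c <- ck]; exists (a *: c); first exact: schur_combZ.
by move=> mu /(fsubsetP (msuppZ_le _ _)) /ck.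
Qed.

Lemma rows_leN f : rows_le k f -> rows_le k (- f).
Proof. by rewrite -scaleN1r; apply: rows_leZ. Qed.

Lemma rows_le_sum (I : eqType) (r : seq I) (P : pred I) (F : I -> Lam) :
  (forall i, i \in r -> P i -> rows_le k (F i)) ->
  rows_le k (\sum_(i <- r | P i) F i).
Proof.
move=> rF; rewrite big_seq_cond.
by elim/big_ind: _ => [||i /andP[/rF]]; [exact: rows_le0 | exact: rows_leD |].
Qed.

Lemma rows_le_schur mu : is_part mu -> (size mu <= k)%N -> rows_le k (schur mu).
Proof.
move=> pmu kmu; exists << (exist _ mu pmu : part) >>.
  by rewrite schur_combU.
by move=> nu; rewrite msuppU oner_eq0 inE => /eqP->.
Qed.

End RowsLe.

(** * Products of three complete functions have at most three rows *)

Lemma eq_jacobi_trudi n mu nu : (forall i, nth 0%N mu i = nth 0%N nu i) ->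
  jacobi_trudi n mu = jacobi_trudi n nu.
Proof.
move=> munu; rewrite /jacobi_trudi; congr (\det _); apply/matrixP => i j.
by rewrite !mxE munu.
Qed.

Lemma rows_le_jacobi_trudi3 a b c : (c <= b <= a)%N ->
  rows_le 3 (jacobi_trudi 3 [:: a; b; c]).
Proof.
move=> abc.
have jtE mu : is_part mu -> (size mu <= 3)%N ->
    (forall i, nth 0 [:: a; b; c] i = nth 0 mu i)%N ->
    rows_le 3 (jacobi_trudi 3 [:: a; b; c]).
  move=> pmu smu /eq_jacobi_trudi ->; rewrite -schurE //.
  exact: rows_le_schur.
(* [is_part] forbids zero parts, so trailing zeros are stripped one by one before the determinant is
   a Schur function. *)
case: c => [|c] in abc jtE *; last first.
  by apply: (jtE [:: a; b; c.+1]) => //; rewrite /is_part /= !inE; lia.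
case: b => [|b] in abc jtE *; last first.
  apply: (jtE [:: a; b.+1]) => //; last by do 4![case=> //].
  by rewrite /is_part /= !inE; lia.
case: a => [|a] in abc jtE *.
  by apply: (jtE [::]) => //; do 4![case=> //].
by apply: (jtE [:: a.+1]) => //; do 4![case=> //].
Qed.

Lemma det_mx2 (R : comPzRingType) (f : nat -> nat -> R) :
  \det (\matrix_(i < 2, j < 2) f i j) =
  f 0%N 0%N * f 1%N 1%N - f 0%N 1%N * f 1%N 0%N.
Proof.
rewrite (expand_det_row _ ord0) !big_ord_recr big_ord0 /= /cofactor.
by rewrite !det_mx11 !mxE /= /bump /=; ring.
Qed.

Lemma det_mx3 (R : comPzRingType) (f : nat -> nat -> R) :
  \det (\matrix_(i < 3, j < 3) f i j) =
  f 0%N 0%N * f 1%N 1%N * f 2 2 - f 0%N 0%N * f 1%N 2 * f 2 1%N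
  - f 0%N 1%N * f 1%N 0%N * f 2 2 + f 0%N 1%N * f 1%N 2 * f 2 0%N
  + f 0%N 2 * f 1%N 0%N * f 2 1%N - f 0%N 2 * f 1%N 1%N * f 2 0%N.
Proof.
rewrite (expand_det_row _ ord0) !big_ord_recr big_ord0 /= /cofactor.
have minor k : \det (row' ord0 (col' k (\matrix_(i < 3, j < 3) f i j))) =
    f 1%N (bump k 0) * f 2 (bump k 1) - f 1%N (bump k 1) * f 2 (bump k 0).
  rewrite -(det_mx2 (fun i j => f (bump 0 i) (bump k j))).
  by congr (\det _); apply/matrixP => i j; rewrite !mxE.
by rewrite !minor !mxE /bump /=; ring.
Qed.

(* Solving the Jacobi-Trudi expansion of the partition (a, b, c) for its
   diagonal term leaves triples that dominate (a, b, c), hence have a smaller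
   second elementary symmetric function. *)
Lemma rows_le_hsym3 a b c : rows_le 3 (hsym a * hsym b * hsym c).
Proof.
have [m] := ubnP (a * b + b * c + a * c)%N.
elim: m a b c => // m IHm a b c lem.
wlog /andP[cb ba] : a b c lem / (c <= b <= a)%N.
  move=> sorted_case.
  have [ab|ba] := leqP a b; have [bc|cb] := leqP b c; have [ac|ca] := leqP a c.
  - rewrite mulrC [hsym a * _]mulrC mulrA; apply: sorted_case; lia.
  - by exfalso; lia.
  - rewrite [hsym a * _]mulrC -mulrA [hsym a * _]mulrC mulrA.
    apply: sorted_case; lia.
  - rewrite [hsym a * _]mulrC; apply: sorted_case; lia.
  - rewrite mulrC mulrA; apply: sorted_case; lia.
  - rewrite -mulrA [hsym b * _]mulrC mulrA; apply: sorted_case; lia.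
  - by exfalso; lia.
  - apply: sorted_case; lia.
pose g i j : Lam := if (i <= nth 0 [:: a; b; c] i + j)%N
  then hsym (nth 0%N [:: a; b; c] i + j - i) else 0.
have g00 : hsym a * hsym b * hsym c = g 0%N 0%N * g 1%N 1%N * g 2 2.
  by rewrite /g /= !addn0 subn0 !addnK leq_addl leq_addl.
have jt : jacobi_trudi 3 [:: a; b; c] = _ := det_mx3 g.
have solve (R : comPzRingType) (d x1 x2 x3 x4 x5 x6 : R) :
    d = x1 - x2 - x3 + x4 + x5 - x6 -> x1 = d + x2 + x3 - x4 - x5 + x6.
  by move=> ->; ring.
rewrite g00 (solve _ _ _ _ _ _ _ _ jt).
have gterm i j k :
    (i, j, k) \in [:: (0, 2, 1); (1, 0, 2); (1, 2, 0); (2, 0, 1); (2, 1, 0)]%N ->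
    rows_le 3 (g 0%N i * g 1%N j * g 2 k).
  rewrite /g /= => ijk.
  case: ifP => jb; last by rewrite mulr0 mul0r; exact: rows_le0.
  case: ifP => kc; last by rewrite mulr0; exact: rows_le0.
  apply: IHm; rewrite subn0; clear -ijk lem cb ba jb kc.
  (* Naming the shifted indices removes truncated subtraction before the nonlinear comparison of the
     measures. *)
  have [b1 Db] : exists b1, (b + j = b1 + 1)%N by exists (b + j - 1)%N; lia.
  have [c1 Dc] : exists c1, (c + k = c1 + 2)%N by exists (c + k - 2)%N; lia.
  rewrite Db Dc !addnK; move: ijk Db Dc {jb kc}.
  case: i => [|[|[|i]]] //; case: j => [|[|[|j]]] //; case: k => [|[|[|k]]] //;
    by move=> _ Db Dc; nia.
apply: rows_leD (gterm 2 1%N 0%N isT).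
apply: rows_leD (rows_leN (gterm 2 0%N 1%N isT)).
apply: rows_leD (rows_leN (gterm 1%N 2 0%N isT)).
apply: rows_leD (gterm 1%N 0%N 2 isT).
apply: rows_leD (gterm 0%N 2 1%N isT).
by apply: rows_le_jacobi_trudi3; rewrite cb.
Qed.

Lemma rows_le_plethysm n : rows_le 3 (plethysm (hsym 3) (hsym n)).
Proof.
have h6 : plethysm (hsym 3) (hsym n) =
    (6%:R^-1 : rat) *: (plethysm (hsym 3) (hsym n) *+ 6).
  by rewrite -scaler_nat scalerA mulVf // scale1r.
rewrite h6 plethysm_h3_hsym; apply: rows_leZ.
apply: rows_leD; first apply: rows_leD.
- by rewrite exprS expr2 mulrA; exact: rows_le_hsym3.
- rewrite -scaler_nat; apply: rows_leZ.
  rewrite adams2_hsym mulr_sumr; apply: rows_le_sum => b _ _.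
  by rewrite -scalerAr mulrA; apply: rows_leZ; exact: rows_le_hsym3.
- rewrite -scaler_nat; apply: rows_leZ.
  have [w ->] := adams3_hsym n.
  apply: rows_le_sum => a _ _; apply: rows_le_sum => b _ _.
  by apply: rows_leZ; exact: rows_le_hsym3.
Qed.

(** * Embedding of the polynomial ring into a field *)

Section Fraction.
Import mpoly.
Context (n : nat).

Definition multinom_of_cmonom (m : {cmonom 'I_n}) : multinom n :=
  Multinom [tuple m i | i < n].

Definition mpolyX_of_cmonom (m : {cmonom 'I_n}) : (mpoly n rat) :=
  mpolyX rat (multinom_of_cmonom m).

Lemma mpolyX_of_cmonom_mmorphism : mmorphism mpolyX_of_cmonom.
Proof.
split=> [m1 m2|]; rewrite /mpolyX_of_cmonom.
  rewrite -mpolyXD; congr mpolyX; apply/mnmP => i.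
  by rewrite mnmDE !mnmE cmM.
rewrite -mpolyX0; congr mpolyX; apply/mnmP => i.
by rewrite mnm0E mnmE cm1.
Qed.

HB.instance Definition _ := monalg.isMultiplicative.Build {cmonom 'I_n}
  (mpoly n rat) mpolyX_of_cmonom mpolyX_of_cmonom_mmorphism.

Definition mpoly_of_malg : {malg rat[{cmonom 'I_n}]} -> (mpoly n rat) :=
  monalg.mmap (@mpolyC n rat) mpolyX_of_cmonom.

HB.instance Definition _ := GRing.RMorphism.copy mpoly_of_malg
  (monalg.mmap (@mpolyC n rat) mpolyX_of_cmonom).

Lemma multinom_of_cmonom_inj : injective multinom_of_cmonom.
Proof.
move=> m1 m2 eqm; apply/eqP/cmP => i.
by have := congr1 (fun m : multinom n => m i) eqm; rewrite !mnmE.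
Qed.

Lemma mcoeff_mpoly_of_malg g m :
  mpoly.mcoeff (multinom_of_cmonom m) (mpoly_of_malg g) = monalg.mcoeff m g.
Proof.
rewrite /mpoly_of_malg monalg.mmapE raddf_sum /=.
rewrite [in RHS](monalgE g) [RHS]raddf_sum /=.
apply: eq_bigr => k _; rewrite mpoly.mcoeffCM mpoly.mcoeffX monalg.mcoeffU.
by rewrite (inj_eq multinom_of_cmonom_inj) mulr_natr.
Qed.

Lemma mpoly_of_malg_inj : injective mpoly_of_malg.
Proof.
by move=> f g eqfg; apply/malgP => m; rewrite -!mcoeff_mpoly_of_malg eqfg.
Qed.

(** Coefficients are preserved on the way to [mpoly], an integral domain, whose fraction field
    allows division by differences of variables. *)
Lemma malg_field_embedding : exists (F : fieldType)
  (phi : {rmorphism {malg rat[{cmonom 'I_n}]} -> F}), injective phi.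
Proof.
exists {fraction (mpoly n rat)}.
exists (@FracField.tofrac (mpoly n rat) \o mpoly_of_malg).
by move=> f g /= /eqP; rewrite tofrac_eq => /eqP /mpoly_of_malg_inj.
Qed.

End Fraction.

(** * The operators on combinations of Schur functions *)

Lemma part_add_is_part mu la :
  is_part mu -> is_part la -> is_part (part_add mu la).
Proof.
move=> pmu pla; apply/andP; split.
  apply: (path_sorted (x := (nth 0 mu 0 + nth 0 la 0)%N)).
  apply/(pathP 0%N) => i; rewrite size_mkseq => imax.
  rewrite /part_add nth_mkseq //; case: i imax => [|i] imax //=.
  rewrite nth_mkseq ?(ltnW imax) // /geq /=.
  by rewrite leq_add // part_nth_le.
apply/(nthP 0%N) => -[i]; rewrite size_mkseq => imax.
rewrite nth_mkseq // => /eqP; rewrite addn_eq0 => /andP[/eqP mu0 /eqP la0].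
have pos nu : is_part nu -> nth 0%N nu i = 0%N -> (size nu <= i)%N.
  case/andP=> _ nz nu0; rewrite leqNgt; apply: contra nz => inu.
  by rewrite -nu0 mem_nth.
by have := pos _ pmu mu0; have := pos _ pla la0; lia.
Qed.

Lemma size_part_add_le k mu la : (size mu <= k)%N -> (size la <= k)%N ->
  (size (part_add mu la) <= k)%N.
Proof. by rewrite size_mkseq geq_max => -> ->. Qed.

Lemma nth_part_add mu la i :
  nth 0%N (part_add mu la) i = (nth 0 mu i + nth 0 la i)%N.
Proof.
case: (ltnP i (maxn (size mu) (size la))) => imax; first by rewrite nth_mkseq.
rewrite nth_default ?size_mkseq //.
by move: imax; rewrite geq_max => /andP[? ?]; rewrite !nth_default.
Qed.

Lemma odot_comb mu (c : {malg rat[part]}) : is_part mu ->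
  odot (schur mu) (schur_comb c) =
  \sum_(la <- msupp c) c@_la *: schur (part_add mu (val la)).
Proof.
move=> pmu; rewrite /odot schur_combK.
rewrite (schur_coord_schur (exist _ mu pmu : part)).
rewrite msuppU oner_eq0 big_seq_fset1.
by apply: eq_bigr => la _; rewrite mcoeffUU mul1r.
Qed.

Lemma down_comb k (c : {malg rat[part]}) : down k (schur_comb c) =
  \sum_(mu <- msupp c | (size (val mu) <= k)%N) c@_mu *: schur (val mu).
Proof. by rewrite /down schur_combK. Qed.

Lemma rows_le_odot k mu f : is_part mu -> (size mu <= k)%N ->
  rows_le k f -> rows_le k (odot (schur mu) f).
Proof.
move=> pmu smu [c <- ck]; rewrite odot_comb //.
apply: rows_le_sum => la cla _; apply: rows_leZ; apply: rows_le_schur.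
  exact: part_add_is_part (valP la).
by rewrite size_mkseq geq_max smu ck.
Qed.

Lemma rows_le_down k l f : rows_le l f -> rows_le k (down k f).
Proof.
move=> [c <- _]; rewrite down_comb; apply: rows_le_sum => mu _ smu.
by apply: rows_leZ; apply: rows_le_schur => //; exact: (valP mu).
Qed.

Lemma rows_leW k l f : (k <= l)%N -> rows_le k f -> rows_le l f.
Proof.
by move=> kl [c <- ck]; exists c => // mu /ck smu; apply: leq_trans kl.
Qed.

Lemma rows_le_h3h m : rows_le 3 (h3h m).
Proof. by case: m => m; [exact: rows_le_plethysm | exact: rows_le0]. Qed.

Lemma schur1 n : schur [:: n] = hsym n.
Proof. by rewrite /schur /jacobi_trudi det_mx11 mxE /= addn0 subn0. Qed.

(** * Evaluation in two and three variables *)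

Section Realize.
Context (S : comAlgType rat).
Implicit Types (x y z : S) (f g : Lam).

Lemma eq_realize N (x y : 'I_N -> S) f : x =1 y -> realize x f = realize y f.
Proof.
by move=> xy; apply: eq_ev => k _; apply: eq_bigr => i _; rewrite xy.
Qed.

Lemma eq_alternant N (x y : 'I_N -> S) mu :
  x =1 y -> alternant x mu = alternant y mu.
Proof.
move=> xy; rewrite /alternant; congr (\det _); apply/matrixP => i j.
by rewrite !mxE xy.
Qed.

Lemma realize_adams N (x : 'I_N -> S) r f : (0 < r)%N ->
  realize x (adams r f) = realize (fun i => x i ^+ r) f.
Proof.
move=> r_gt0; rewrite /adams rmorph_ev; apply: eq_ev => k k_gt0 /=.
rewrite [LHS]ev_psum ?muln_gt0 ?r_gt0 //.
by apply: eq_bigr => i _; rewrite exprM.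
Qed.

Lemma realize_plethysm_h3 N (x : 'I_N -> S) f :
  let h k := realize (fun i => x i ^+ k) f in
  realize x (plethysm (hsym 3) f) *+ 6 =
  h 1%N ^+ 3 + h 1%N * h 2 *+ 3 + h 3 *+ 2.
Proof.
move=> h; pose u k := realize x (adams k f).
have uh k : (0 < k)%N -> u k = h k by exact: realize_adams.
have : realize x (plethysm (hsym 3) f) = ev u (hsym 3) := rmorph_ev _ _ _.
by move=> ->; rewrite ev_hsym3; move: u h uh => u h uh; rewrite !uh.
Qed.

Lemma mul_realize_sum N (x : 'I_N -> S) a (r : seq part) (P : pred part)
    (c : part -> rat) (F : part -> Lam) :
  a * realize x (\sum_(mu <- r | P mu) c mu *: F mu) =
  \sum_(mu <- r | P mu) c mu *: (a * realize x (F mu)).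
Proof.
rewrite (raddf_sum (realize x)) mulr_sumr; apply: eq_bigr => mu _.
by rewrite scalerAr; congr (a * _); exact: ev_scalable.
Qed.

Lemma mul_realize_comb N (x : 'I_N -> S) a c : a * realize x (schur_comb c) =
  \sum_(mu <- msupp c) c@_mu *: (a * realize x (schur (val mu))).
Proof. exact: (mul_realize_sum x a). Qed.

Lemma mul_realize_odot N (x : 'I_N -> S) a mu c : is_part mu ->
  a * realize x (odot (schur mu) (schur_comb c)) = \sum_(la <- msupp c)
    c@_la *: (a * realize x (schur (part_add mu (val la)))).
Proof. by move/odot_comb=> ->; exact: (mul_realize_sum x a). Qed.

Definition pts2 x y (i : 'I_2) : S := nth 0 [:: x; y] i.
Definition pts3 x y z (i : 'I_3) : S := nth 0 [:: x; y; z] i.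

(** Multiplying by the Vandermonde determinant turns a Schur function with few enough rows into an
    alternant, where adding a partition just shifts exponents. *)
Definition alt2 x y f := alternant (pts2 x y) [::] * realize (pts2 x y) f.
Definition alt3 x y z f := alternant (pts3 x y z) [::] * realize (pts3 x y z) f.

Lemma alternant2 x y mu : alternant (pts2 x y) mu =
  x ^+ (nth 0 mu 0).+1 * y ^+ (nth 0 mu 1)
  - y ^+ (nth 0 mu 0).+1 * x ^+ (nth 0 mu 1).
Proof.
rewrite /alternant.
rewrite (det_mx2 (fun i j => nth 0 [:: x; y] j ^+ (nth 0 mu i + (2 - i.+1))%N)).
by rewrite /= addn0 addn1.
Qed.

Lemma alternant3 x y z mu :
  let a := (nth 0%N mu 0).+2 in let b := (nth 0%N mu 1).+1 in
  let c := nth 0%N mu 2 in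
  alternant (pts3 x y z) mu =
  x ^+ a * y ^+ b * z ^+ c - x ^+ a * z ^+ b * y ^+ c
  - y ^+ a * x ^+ b * z ^+ c + y ^+ a * z ^+ b * x ^+ c
  + z ^+ a * x ^+ b * y ^+ c - z ^+ a * y ^+ b * x ^+ c.
Proof.
rewrite /alternant.
rewrite (det_mx3 (fun i j =>
  nth 0 [:: x; y; z] j ^+ (nth 0 mu i + (3 - i.+1))%N)).
by rewrite /= addn0 addn1 addn2.
Qed.

Lemma alt2_schur x y mu : (size mu <= 2)%N ->
  alt2 x y (schur mu) = alternant (pts2 x y) mu.
Proof. exact: schur_bialternant. Qed.

Lemma alt3_schur x y z mu : (size mu <= 3)%N ->
  alt3 x y z (schur mu) = alternant (pts3 x y z) mu.
Proof. exact: schur_bialternant. Qed.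

Lemma alt2_odot66 x y g : rows_le 2 g ->
  alt2 x y (odot (schur [:: 6; 6]%N) g) = (x * y) ^+ 6 * alt2 x y g.
Proof.
case=> c <- ck; rewrite /alt2 mul_realize_comb.
rewrite (mul_realize_odot _ _ _ (isT : is_part [:: 6; 6]%N)) mulr_sumr.
rewrite big_seq [RHS]big_seq; apply: eq_bigr => mu /ck smu.
rewrite -scalerAr; congr (_ *: _).
rewrite -/(alt2 _ _ _) -/(alt2 _ _ _) (alt2_schur x y smu).
rewrite alt2_schur; last exact: size_part_add_le.
by rewrite !alternant2 !nth_part_add /= -!addnS !exprD; ring.
Qed.

(** When the third part is 0, the last row of the alternant consists of ones, and Laplace expansion
    along it leaves two-variable alternants. Their exponents are raised by 1 by the staircase of
    length three, whence the factors [x * y], [x * z], [y * z]. *)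
Lemma alt3_rows_le2 x y z g : rows_le 2 g ->
  alt3 x y z g =
  x * y * alt2 x y g - x * z * alt2 x z g + y * z * alt2 y z g.
Proof.
case=> c <- ck; rewrite /alt3 /alt2 !mul_realize_comb.
rewrite !mulr_sumr -sumrN -!big_split.
rewrite big_seq [RHS]big_seq; apply: eq_bigr => mu /ck smu /=.
rewrite -!scalerAr -scalerN -!scalerDr; congr (_ *: _).
rewrite -/(alt3 _ _ _ _) -!/(alt2 _ _ _).
rewrite !(alt2_schur _ _ smu) (alt3_schur _ _ _ (leqW smu)).
rewrite alternant3 !alternant2 [nth _ _ 2]nth_default //.
by rewrite !exprS expr0; ring.
Qed.

(** The same expansion, now with last row [x, y, z] since the third part is 1; the other exponents
    rise by 4 from the partition and by 1 from the longer staircase. *)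
Lemma alt3_odot441 x y z g : rows_le 2 g ->
  alt3 x y z (odot (schur [:: 4; 4; 1]%N) g) =
  z * (x * y) ^+ 5 * alt2 x y g - y * (x * z) ^+ 5 * alt2 x z g
  + x * (y * z) ^+ 5 * alt2 y z g.
Proof.
case=> c <- ck; rewrite /alt3 /alt2 !mul_realize_comb.
rewrite (mul_realize_odot _ _ _ (isT : is_part [:: 4; 4; 1]%N)).
rewrite !mulr_sumr -sumrN -!big_split.
rewrite big_seq [RHS]big_seq; apply: eq_bigr => mu /ck smu /=.
rewrite -!scalerAr -scalerN -!scalerDr; congr (_ *: _).
rewrite -/(alt3 _ _ _ _) -!/(alt2 _ _ _).
rewrite !(alt2_schur _ _ smu) alt3_schur; last first.
  exact: size_part_add_le (leqW smu).
rewrite alternant3 !alternant2 !nth_part_add [nth _ (val _) 2]nth_default //=.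
by rewrite -!addnS !exprD !exprS !expr0; ring.
Qed.

Lemma alt3_odot222 x y z f : rows_le 3 f ->
  alt3 x y z (odot (schur [:: 2; 2; 2]%N) f) = (x * y * z) ^+ 2 * alt3 x y z f.
Proof.
case=> c <- ck; rewrite /alt3 mul_realize_comb.
rewrite (mul_realize_odot _ _ _ (isT : is_part [:: 2; 2; 2]%N)) mulr_sumr.
rewrite big_seq [RHS]big_seq; apply: eq_bigr => mu /ck smu.
rewrite -scalerAr; congr (_ *: _).
rewrite -/(alt3 _ _ _ _) -/(alt3 _ _ _ _) (alt3_schur x y z smu).
rewrite alt3_schur; last exact: size_part_add_le.
by rewrite !alternant3 !nth_part_add /= -!addnS !exprD; ring.
Qed.

End Realize.

(** * The recursions as identities of rational functions *)

Section RationalIdentities.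
Context (F : fieldType).
Implicit Types x y z a b c : F.

(* [h_n] in two and three variables, where [a], [b], [c] stand for the powers
   with exponent [n + 1], respectively [n + 2], of the variables. *)
Definition hq2 x y a b := (a - b) / (x - y).
Definition hq3 x y z a b c :=
  (a * (y - z) - b * (x - z) + c * (x - y)) / ((x - y) * (y - z) * (x - z)).

(* [6 h_3[h_n]] in two and three variables. *)
Definition pq2 x y a b :=
  hq2 x y a b ^+ 3 + hq2 x y a b * hq2 (x ^+ 2) (y ^+ 2) (a ^+ 2) (b ^+ 2) *+ 3
  + hq2 (x ^+ 3) (y ^+ 3) (a ^+ 3) (b ^+ 3) *+ 2.
Definition pq3 x y z a b c :=
  hq3 x y z a b c ^+ 3
  + hq3 x y z a b c *
    hq3 (x ^+ 2) (y ^+ 2) (z ^+ 2) (a ^+ 2) (b ^+ 2) (c ^+ 2) *+ 3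
  + hq3 (x ^+ 3) (y ^+ 3) (z ^+ 3) (a ^+ 3) (b ^+ 3) (c ^+ 3) *+ 2.

(** These differences are the denominators occurring in [pq2] and [pq3]. *)
Definition separated x y :=
  [/\ x - y != 0, x ^+ 2 - y ^+ 2 != 0 & x ^+ 3 - y ^+ 3 != 0].

(* The sum of the [x ^ (3 n + 1 - k) y ^ k] for [2 <= k <= n], plus
   [x ^ (3 n + 1)], where [n = m + 2], [a = x ^ m] and [b = y ^ m]. *)
Definition two_row_sum x y a b :=
  (x ^+ 2 * a) ^+ 2 * x * y ^+ 2 * (x * a - y * b) / (x - y)
  + (x ^+ 2 * a) ^+ 3 * x.

(** The values [a = b = 1] encode [n = -1]: there the rational function agrees with the convention
    for negative indices. *)
Lemma pq2_1 x y : pq2 x y 1 1 = 0.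
Proof. by rewrite /pq2 /hq2 !expr1n subrr !mul0r expr0n !mul0rn !addr0. Qed.

(** The case [n = 2] stands apart: the index [n - 4 = -2] would require the exponent -1. *)
Lemma pq2_h2 x y : separated x y ->
  (x - y) * pq2 x y (x ^+ 3) (y ^+ 3) =
  (two_row_sum x y 1 1 - two_row_sum y x 1 1) *+ 6.
Proof.
case=> xy1 xy2 xy3; rewrite /pq2 /two_row_sum /hq2; field.
by rewrite xy1 xy2 xy3 -opprB oppr_eq0 xy1.
Qed.

(** With [a = x^m], [b = y^m] and [n = m + 3], the exponents are [n + 1 = m + 4] on the left and
    [(n - 4) + 1 = m] on the right. *)
Lemma pq2_rec x y a b : separated x y ->
  (x - y) * pq2 x y (x ^+ 4 * a) (y ^+ 4 * b) =
  (x * y) ^+ 6 * ((x - y) * pq2 x y a b)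
  + (two_row_sum x y (x * a) (y * b) - two_row_sum y x (y * b) (x * a)) *+ 6.
Proof.
case=> xy1 xy2 xy3; rewrite /pq2 /two_row_sum /hq2; field.
by rewrite xy1 xy2 xy3 -opprB oppr_eq0 xy1.
Qed.

(** With [a = x^m] and so on, and [n = m + 2], the exponents are [n + 2] for [h_n] and [n] for
    [h_(n-2)] in three variables, [n + 1] for [h_n] and [n - 2] for [h_(n-3)] in two. The summands
    on the right are the images of the three terms of the second recursion. *)
Lemma pq3_rec x y z a b c : separated x y -> separated x z -> separated y z ->
  (x - y) * (y - z) * (x - z) *
    pq3 x y z (x ^+ 4 * a) (y ^+ 4 * b) (z ^+ 4 * c) =
  (x * y * ((x - y) * pq2 x y (x ^+ 3 * a) (y ^+ 3 * b))
   - x * z * ((x - z) * pq2 x z (x ^+ 3 * a) (z ^+ 3 * c))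
   + y * z * ((y - z) * pq2 y z (y ^+ 3 * b) (z ^+ 3 * c)))
  + (x * y * z) ^+ 2 * ((x - y) * (y - z) * (x - z) *
      pq3 x y z (x ^+ 2 * a) (y ^+ 2 * b) (z ^+ 2 * c))
  + (z * (x * y) ^+ 5 * ((x - y) * pq2 x y a b)
     - y * (x * z) ^+ 5 * ((x - z) * pq2 x z a c)
     + x * (y * z) ^+ 5 * ((y - z) * pq2 y z b c)).
Proof.
case=> xy1 xy2 xy3 [xz1 xz2 xz3] [yz1 yz2 yz3].
rewrite /pq3 /pq2 /hq3 /hq2; field.
by rewrite xy1 xy2 xy3 xz1 xz2 xz3 yz1 yz2 yz3.
Qed.

End RationalIdentities.

(** * Transfer of the rational identities to symmetric functions *)

Section Embedded.
Context (S : comAlgType rat) (F : fieldType) (phi : {rmorphism S -> F}).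
Hypothesis phi_inj : injective phi.
Implicit Types (x y z : S) (f g : Lam).

Lemma alt2E x y f : alt2 x y f = (x - y) * realize (pts2 x y) f.
Proof. by rewrite /alt2 alternant2 !nth_nil !expr1 !expr0 !mulr1. Qed.

Lemma alt3E x y z f :
  alt3 x y z f = (x - y) * (y - z) * (x - z) * realize (pts3 x y z) f.
Proof.
rewrite /alt3 alternant3 !nth_nil; congr (_ * _).
by rewrite !expr0 !expr1; ring.
Qed.

(* This is the bialternant formula in three variables at [z = 0]. *)
Lemma alt2_schur_eq0 x y mu : phi x != 0 -> phi y != 0 -> is_part mu ->
  size mu = 3 -> alt2 x y (schur mu) = 0.
Proof.
move=> x0 y0 pmu smu.
have mu2 : (0 < nth 0 mu 2)%N.
  case/andP: pmu => _ nz; rewrite lt0n; apply: contra nz => /eqP <-.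
  by rewrite mem_nth // smu.
have r3 : realize (pts3 x y 0) (schur mu) = realize (pts2 x y) (schur mu).
  apply: eq_ev => k k0; rewrite !big_ord_recr /= /pts3 /pts2 /= !big_ord0.
  by rewrite [0 ^+ k]expr0n eqn0Ngt k0 addr0.
have := alt3_schur x y 0 (eq_leq smu).
(* The exponents of [z] in the alternant are all positive, as [mu_3 > 0], so every term vanishes. *)
have z0 k : (0 < k)%N -> (0 : S) ^+ k = 0 by rewrite expr0n lt0n => /negbTE ->.
rewrite alternant3 (z0 _ mu2) !(z0 _.+1) // !(mulr0, mul0r) !subr0 !addr0.
rewrite alt3E r3 !subr0 => /(congr1 phi); rewrite alt2E.
(* At [z = 0] the Vandermonde determinant is [x y] times the one in two variables, and [x y] is
   cancelled in the field. *)
have -> r : (x - y) * y * x * r = x * y * ((x - y) * r) by ring.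
rewrite rmorph0 [phi (x * y * _)]rmorphM [phi (x * y)]rmorphM => /eqP.
rewrite !mulf_eq0 (negbTE x0) (negbTE y0) /= => /eqP e.
by apply: phi_inj; rewrite e rmorph0.
Qed.

Lemma alt2_down x y f : phi x != 0 -> phi y != 0 -> rows_le 3 f ->
  alt2 x y (down 2 f) = alt2 x y f.
Proof.
move=> x0 y0 [c <- ck]; rewrite down_comb /alt2 mul_realize_comb.
rewrite (mul_realize_sum _ _ _ _ (fun mu => c@_mu) (fun mu => schur (val mu))).
rewrite [RHS](bigID (fun mu : part => (size (val mu) <= 2)%N)) /=.
rewrite [X in _ = _ + X]big1_seq ?addr0 // => mu /andP[mu2 /ck mu3].
have smu : size (val mu) = 3.
  by apply/eqP; rewrite eqn_leq mu3 ltnNge.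
by rewrite -/(alt2 _ _ _) (alt2_schur_eq0 x0 y0 (valP mu) smu) scaler0.
Qed.

Lemma phi_hsym2 x y n : phi x - phi y != 0 ->
  phi (realize (pts2 x y) (hsym n)) =
  hq2 (phi x) (phi y) (phi x ^+ n.+1) (phi y ^+ n.+1).
Proof.
move=> xy; rewrite /hq2; apply: (mulfI xy); rewrite mulrCA mulfV // mulr1.
have := alt2_schur x y (isT : (size [:: n] <= 2)%N).
rewrite schur1 alt2E alternant2 /= !expr0 !mulr1 => /(congr1 phi).
by rewrite rmorphM !rmorphB !rmorphXn.
Qed.

Lemma phi_hsym3 x y z n :
  phi x - phi y != 0 -> phi y - phi z != 0 -> phi x - phi z != 0 ->
  phi (realize (pts3 x y z) (hsym n)) =
  hq3 (phi x) (phi y) (phi z)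
    (phi x ^+ n.+2) (phi y ^+ n.+2) (phi z ^+ n.+2).
Proof.
move=> xy yz xz.
have nz : (phi x - phi y) * (phi y - phi z) * (phi x - phi z) != 0.
  by rewrite !mulf_neq0.
rewrite /hq3; apply: (mulfI nz); rewrite mulrCA mulfV // mulr1.
have := alt3_schur x y z (isT : (size [:: n] <= 3)%N).
rewrite schur1 alt3E alternant3 /= !expr0 !expr1 !mulr1 => /(congr1 phi).
rewrite rmorphM rmorphM rmorphM !rmorphB => ->.
rewrite -!rmorphXn; move: (x ^+ n.+2) (y ^+ n.+2) (z ^+ n.+2) => a b c; ring.
Qed.

Lemma phi_alt2_plethysm x y n : separated (phi x) (phi y) ->
  phi (alt2 x y (plethysm (hsym 3) (hsym n))) *+ 6 =
  (phi x - phi y) * pq2 (phi x) (phi y) (phi x ^+ n.+1) (phi y ^+ n.+1).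
Proof.
case=> xy1 xy2 xy3; rewrite alt2E rmorphM rmorphB -mulrnAr -rmorphMn.
have hk k : phi x ^+ k - phi y ^+ k != 0 ->
    phi (realize (fun i => pts2 x y i ^+ k) (hsym n)) =
    hq2 (phi x ^+ k) (phi y ^+ k) ((phi x ^+ n.+1) ^+ k) ((phi y ^+ n.+1) ^+ k).
  rewrite -!rmorphXn => xyk.
  rewrite (eq_realize (y := pts2 (x ^+ k) (y ^+ k))); last by case=> [[|[|]]].
  by rewrite phi_hsym2 // -!rmorphXn -!exprM mulnC.
rewrite realize_plethysm_h3 2!rmorphD !rmorphMn rmorphXn rmorphM.
by rewrite !hk // !expr1.
Qed.

Lemma phi_alt3_plethysm x y z n :
  separated (phi x) (phi y) -> separated (phi x) (phi z) ->
  separated (phi y) (phi z) ->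
  phi (alt3 x y z (plethysm (hsym 3) (hsym n))) *+ 6 =
  (phi x - phi y) * (phi y - phi z) * (phi x - phi z) *
  pq3 (phi x) (phi y) (phi z) (phi x ^+ n.+2) (phi y ^+ n.+2) (phi z ^+ n.+2).
Proof.
case=> xy1 xy2 xy3 [xz1 xz2 xz3] [yz1 yz2 yz3].
rewrite alt3E 3!rmorphM !rmorphB -mulrnAr -rmorphMn.
have hk k : phi x ^+ k - phi y ^+ k != 0 -> phi y ^+ k - phi z ^+ k != 0 ->
    phi x ^+ k - phi z ^+ k != 0 ->
    phi (realize (fun i => pts3 x y z i ^+ k) (hsym n)) =
    hq3 (phi x ^+ k) (phi y ^+ k) (phi z ^+ k)
      ((phi x ^+ n.+2) ^+ k) ((phi y ^+ n.+2) ^+ k) ((phi z ^+ n.+2) ^+ k).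
  rewrite -!rmorphXn => xyk yzk xzk.
  rewrite (eq_realize (y := pts3 (x ^+ k) (y ^+ k) (z ^+ k))); last first.
    by case=> [[|[|[|]]]].
  by rewrite phi_hsym3 // -!rmorphXn -!exprM mulnC.
rewrite realize_plethysm_h3 2!rmorphD !rmorphMn rmorphXn rmorphM.
by rewrite !hk // !expr1.
Qed.

Lemma separated_phi x y : (forall k, (0 < k)%N -> x ^+ k != y ^+ k) ->
  separated (phi x) (phi y).
Proof.
move=> neq; have sep k : (0 < k)%N -> phi x ^+ k - phi y ^+ k != 0.
  by move=> k0; rewrite -!rmorphXn subr_eq0 (inj_eq phi_inj) neq.
by split; rewrite ?sep // -[phi x]expr1 -[phi y]expr1 sep.
Qed.

Lemma phi_mulr6_inj (a b : S) : phi a *+ 6 = phi b *+ 6 -> a = b.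
Proof.
rewrite -!rmorphMn => /phi_inj; rewrite -!(scaler_nat 6).
exact: scale_natSI.
Qed.

Lemma alt2D x y f g : alt2 x y (f + g) = alt2 x y f + alt2 x y g.
Proof. by rewrite /alt2 -mulrDr -raddfD. Qed.

Lemma alt3D x y z f g h :
  alt3 x y z (f + g + h) = alt3 x y z f + alt3 x y z g + alt3 x y z h.
Proof. by rewrite /alt3 -!mulrDr -!raddfD. Qed.

Lemma alt2_0 x y : alt2 x y 0 = 0.
Proof. by rewrite /alt2 raddf0 mulr0. Qed.

Lemma alt2_sum x y m n (G : nat -> Lam) :
  alt2 x y (\sum_(m <= k < n) G k) = \sum_(m <= k < n) alt2 x y (G k).
Proof. by rewrite /alt2 (raddf_sum (realize (pts2 x y))) mulr_sumr. Qed.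

(** Indexing by [m - 1] treats the index -1 uniformly with the natural ones, as both recursions
    reach it. *)
Lemma phi_alt2_h3h_pred x y m : separated (phi x) (phi y) ->
  phi (alt2 x y (h3h (m%:Z - 1))) *+ 6 =
  (phi x - phi y) * pq2 (phi x) (phi y) (phi x ^+ m) (phi y ^+ m).
Proof.
move=> sxy; case: m => [|m].
  have -> : h3h (0%:Z - 1) = 0 by [].
  by rewrite alt2_0 rmorph0 mul0rn !expr0 pq2_1 mulr0.
have -> : m.+1%:Z - 1 = m%:Z by lia.
exact: phi_alt2_plethysm.
Qed.

Lemma phi_alt2_two_rows x y m : phi x - phi y != 0 ->
  let n := m.+2 in
  phi (alt2 x y (\sum_(2 <= k < n.+1) schur [:: (3 * n - k)%N; k]
                 + schur [:: (3 * n)%N])) =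
  two_row_sum (phi x) (phi y) (phi x ^+ m) (phi y ^+ m)
  - two_row_sum (phi y) (phi x) (phi y ^+ m) (phi x ^+ m).
Proof.
move=> xy n; rewrite alt2D alt2_sum.
rewrite (alt2_schur x y (isT : (size [:: _] <= 2)%N)) alternant2 /=.
(* Pulling out [a^(2n+1) b^2] leaves the sum of [a^(m-i) b^i] over [i <= m], which is
   [(a^(m+1) - b^(m+1)) / (a - b)]. *)
have geo (a b : F) : a - b != 0 ->
    \sum_(2 <= k < n.+1) a ^+ (3 * n - k).+1 * b ^+ k =
    (a ^+ 2 * a ^+ m) ^+ 2 * a * b ^+ 2 * (a * a ^+ m - b * b ^+ m) / (a - b).
  move=> ab; rewrite -!exprS subrXX -mulrA [(a - b) * _ / _]mulrAC.
  rewrite mulfV // mul1r.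
  rewrite (big_addn 0 _ 2) (_ : (n.+1 - 2)%N = m.+1) // big_mkord mulr_sumr.
  apply: eq_bigr => i _; have im := ltn_ord i.
  have -> : (3 * n - (i + 2)).+1 = (m.+2 * 2 + 1 + (m - i))%N.
    by rewrite /n; lia.
  rewrite [a ^+ (_ + _)]exprD [a ^+ (_ + 1)]exprD exprM expr1 [b ^+ _]exprD.
  rewrite (_ : a ^+ m.+2 = a ^+ 2 * a ^+ m); last by rewrite -exprD.
  by rewrite /=; move: (a ^+ (m - i)) (a ^+ m) (b ^+ i) => c d e; ring.
(* The negative monomials of the alternants give the same sum with the variables exchanged. *)
rewrite /two_row_sum -geo // -geo; last by rewrite -opprB oppr_eq0.
rewrite rmorphD rmorph_sum.
have -> : \sum_(2 <= k < n.+1) phi (alt2 x y (schur [:: (3 * n - k)%N; k])) =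
    \sum_(2 <= k < n.+1) phi x ^+ (3 * n - k).+1 * phi y ^+ k -
    \sum_(2 <= k < n.+1) phi y ^+ (3 * n - k).+1 * phi x ^+ k.
  rewrite -sumrB; apply: eq_bigr => k _.
  rewrite (alt2_schur x y (isT : (size [:: _; _] <= 2)%N)) alternant2 /=.
  by rewrite rmorphB 2!rmorphM !rmorphXn.
have e (a : F) : (a ^+ 2 * a ^+ m) ^+ 3 * a = a ^+ (3 * n).+1.
  by rewrite -exprD -exprM -exprSr mulnC.
by rewrite !expr0 !mulr1 rmorphB !rmorphXn !e addrACA -opprD.
Qed.

Lemma alt2_h3h x y m :
  phi x != 0 -> phi y != 0 -> separated (phi x) (phi y) ->
  let n := m.+2 in
  alt2 x y (down 2 (h3h n%:Z)) =
  alt2 x y (odot (schur [:: 6; 6]%N) (down 2 (h3h (n%:Z - 4)))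
    + \sum_(2 <= k < n.+1) schur [:: (3 * n - k)%N; k] + schur [:: (3 * n)%N]).
Proof.
move=> x0 y0 sxy n; apply: phi_mulr6_inj.
have [xy1 _ _] := sxy.
rewrite -addrA alt2D rmorphD mulrnDl (phi_alt2_two_rows _ xy1).
rewrite (alt2_down x0 y0 (rows_le_h3h _)).
rewrite (alt2_odot66 x y (rows_le_down 2 (rows_le_h3h _))).
rewrite (alt2_down x0 y0 (rows_le_h3h _)).
have -> : phi (alt2 x y (h3h n)) *+ 6 =
    (phi x - phi y) * pq2 (phi x) (phi y) (phi x ^+ m.+3) (phi y ^+ m.+3).
  exact: phi_alt2_plethysm.
rewrite rmorphM rmorphXn rmorphM -mulrnAr.
(* For [n = 2] the term of index -2 is 0 by convention; otherwise [n - 4] is at least -1. *)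
case: m @n => [|m] n.
  have -> : h3h (n%:Z - 4) = 0 by [].
  by rewrite alt2_0 rmorph0 mul0rn mulr0 add0r !expr0; exact: pq2_h2.
have -> : n%:Z - 4 = m%:Z - 1 by rewrite /n; lia.
rewrite phi_alt2_h3h_pred //.
rewrite (exprD _ 4 m) (exprD _ 4 m) !(exprS _ m); exact: pq2_rec.
Qed.

Lemma alt3_h3h x y z m : phi x != 0 -> phi y != 0 -> phi z != 0 ->
  separated (phi x) (phi y) -> separated (phi x) (phi z) ->
  separated (phi y) (phi z) ->
  let n := m.+2 in
  alt3 x y z (h3h n%:Z) =
  alt3 x y z (down 2 (h3h n%:Z)
       + odot (schur [:: 2; 2; 2]%N) (h3h (n%:Z - 2))
       + odot (schur [:: 4; 4; 1]%N) (down 2 (h3h (n%:Z - 3)))).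
Proof.
move=> x0 y0 z0 sxy sxz syz n; apply: etrans _ (esym (alt3D x y z _ _ _)).
have sum3 (a a1 a2 a3 : S) (b b1 b2 b3 : F) :
    phi a *+ 6 = b -> phi a1 *+ 6 = b1 -> phi a2 *+ 6 = b2 ->
    phi a3 *+ 6 = b3 -> b = b1 + b2 + b3 -> a = a1 + a2 + a3.
  move=> <- <- <- <- e; apply: phi_mulr6_inj.
  by rewrite e !rmorphD !mulrnDl.
have combine (a1 a2 a3 b1 b2 b3 : S) : phi (a1 * b1 - a2 * b2 + a3 * b3) *+ 6 =
    phi a1 * (phi b1 *+ 6) - phi a2 * (phi b2 *+ 6) + phi a3 * (phi b3 *+ 6).
  by rewrite rmorphD rmorphB 3!rmorphM mulrnDl mulrnBl -!mulrnAr.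
have r2 k : rows_le 2 (down 2 (h3h k)).
  exact: (rows_le_down 2 (rows_le_h3h k)).
have dE u v k : phi u != 0 -> phi v != 0 ->
    alt2 u v (down 2 (h3h k)) = alt2 u v (h3h k).
  by move=> u0 v0; exact: alt2_down (rows_le_h3h _).
(* Splitting off the fixed exponents leaves the [m]-th powers, which take the place of [a], [b], [c]
   in [pq3_rec]. *)
have pX (a : F) : (a ^+ m.+4 = a ^+ 4 * a ^+ m) * (a ^+ m.+3 = a ^+ 3 * a ^+ m)
    * (a ^+ m.+2 = a ^+ 2 * a ^+ m) by rewrite -!exprD.
apply: sum3 (pq3_rec (phi x ^+ m) (phi y ^+ m) (phi z ^+ m) sxy sxz syz).
- by rewrite -!pX; exact: phi_alt3_plethysm.
- have e2 u v : separated (phi u) (phi v) -> phi (alt2 u v (h3h n)) *+ 6 =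
      (phi u - phi v) * pq2 (phi u) (phi v) (phi u ^+ m.+3) (phi v ^+ m.+3).
    exact: phi_alt2_plethysm.
  rewrite (alt3_rows_le2 x y z (r2 _)) !dE // combine !e2 // !pX.
  by rewrite [phi (x * y)]rmorphM [phi (x * z)]rmorphM [phi (y * z)]rmorphM.
- have -> : n%:Z - 2 = m%:Z by rewrite /n; lia.
  rewrite (alt3_odot222 x y z (rows_le_h3h _)) [phi (_ * alt3 _ _ _ _)]rmorphM.
  by rewrite -mulrnAr phi_alt3_plethysm // rmorphXn !rmorphM !pX.
- have -> : n%:Z - 3 = m%:Z - 1 by rewrite /n; lia.
  rewrite (alt3_odot441 x y z (r2 _)) !dE // combine !phi_alt2_h3h_pred //.
  by rewrite ![phi (_ * _ ^+ 5)]rmorphM !rmorphXn ![phi (_ * _)]rmorphM.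
Qed.

End Embedded.

(** * Three independent variables and the two recursions *)

Lemma pts3E (S : comAlgType rat) (v : 'I_3 -> S) :
  pts3 (v 0) (v 1) (v 2%:R) =1 v.
Proof. by case=> [[|[|[|]]]] // lti; congr v; apply/val_inj. Qed.

Lemma prod_exp1 (S : comPzRingType) (I : finType) (v : I -> S) i k :
  \prod_j v j ^+ (if j == i then k else 0%N) = v i ^+ k.
Proof.
rewrite (bigD1 i) //= eqxx big1 ?mulr1 // => j /negbTE ->.
exact: expr0.
Qed.

Lemma malgU_inj (K : choiceType) :
  injective (fun k : K => << k >> : {malg rat[K]}).
Proof.
move=> k k' /(congr1 (mcoeff k)); rewrite mcoeffUU mcoeffU.
by case: (k' =P k) => [-> //|_ /eqP]; rewrite mulr0n oner_eq0.
Qed.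

Section ThreeVariables.

Let S : comAlgType rat := {malg rat[{cmonom 'I_3}]}.
Let var (i : 'I_3) : S := << ucm i >>.
Let alt := alt3 (var 0) (var 1) (var 2%:R).

(** By [comb_coef] each coordinate with at most three rows is the coefficient of one monomial of
    [alt]; all other coordinates vanish on both sides. *)
Lemma alt3_var_inj f g : rows_le 3 f -> rows_le 3 g -> alt f = alt g -> f = g.
Proof.
have altE c :
    alt (schur_comb c) = alternant var [::] * realize var (schur_comb c).
  by rewrite /alt /alt3 (eq_alternant _ (pts3E var)) (eq_realize _ (pts3E var)).
move=> [c <- ck] [d <- dk] cd.
have {}cd := etrans (esym (altE c)) (etrans cd (altE d)).
apply: (congr1 schur_comb).
apply/malgP => nu; have [snu|snu] := leqP (size (val nu)) 3.
  apply: etrans (esym (comb_coef ck snu)) (etrans _ (comb_coef dk snu)).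
  exact: (congr1 _ cd).
have outside (e : {malg rat[part]}) :
    (forall mu : part, mu \in msupp e -> (size (val mu) <= 3)%N) -> e@_nu = 0.
  move=> ek; apply: mcoeff_outdom; apply: contraL snu => /ek.
  by rewrite -leqNgt.
by rewrite !outside.
Qed.

Lemma var_expE i k : exists2 m : {cmonom 'I_3}, var i ^+ k = << m >> :> S &
  m i = k /\ (forall j, j != i -> m j = 0%N).
Proof.
pose b j := if j == i then k else 0%N.
pose m : {cmonom 'I_3} :=
  \big[mmul/mone]_(j < 3) iter (b j) (mmul (ucm j)) mone.
have bE : \prod_(j < 3) var j ^+ b j = << m >> := prod_var b.
exists m; last first.
  by split=> [|j /negbTE ji]; rewrite [m _]monE /b ?eqxx ?ji.
exact: etrans (esym (prod_exp1 var i k)) bE.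
Qed.

(** Powers of different variables are different basis monomials; this makes the variables
    [separated]. *)
Lemma var_exp_neq i j k : i != j -> (0 < k)%N -> var i ^+ k != var j ^+ k.
Proof.
move=> ij k0; have [m Em [mi _]] := var_expE i k.
have [m' Em' [_ m'j]] := var_expE j k; apply/eqP => eqij.
have mm' := malgU_inj (etrans (esym Em) (etrans eqij Em')).
by move: (m'j i ij) k0; rewrite -mm' mi => ->.
Qed.

Lemma var_neq0 i : var i != 0.
Proof. by rewrite monalgU_eq0 oner_eq0. Qed.

Lemma h3h_rec m : let n := m.+2 in
  down 2 (h3h n%:Z) =
    odot (schur [:: 6; 6]%N) (down 2 (h3h (n%:Z - 4)))
    + \sum_(2 <= k < n.+1) schur [:: (3 * n - k)%N; k]
    + schur [:: (3 * n)%N]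
  /\
  h3h n%:Z =
    down 2 (h3h n%:Z)
    + odot (schur [:: 2; 2; 2]%N) (h3h (n%:Z - 2))
    + odot (schur [:: 4; 4; 1]%N) (down 2 (h3h (n%:Z - 3))).
Proof.
move=> n; have [F [phi phi_inj]] := malg_field_embedding 3.
have nz i : phi (var i) != 0.
  by rewrite -(rmorph0 phi) (inj_eq phi_inj) var_neq0.
have sep i j : i != j -> separated (phi (var i)) (phi (var j)).
  by move=> ij; apply: (separated_phi phi_inj) => k; exact: var_exp_neq.
have sxy := sep 0 1 isT; have sxz := sep 0 2%:R isT.
have syz := sep 1 2%:R isT.
have r2 k : rows_le 2 (down 2 (h3h k)).
  exact: (rows_le_down 2 (rows_le_h3h k)).
have rR : rows_le 2 (odot (schur [:: 6; 6]%N) (down 2 (h3h (n%:Z - 4)))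
    + \sum_(2 <= k < n.+1) schur [:: (3 * n - k)%N; k] + schur [:: (3 * n)%N]).
  apply: rows_leD; first apply: rows_leD.
  - exact: rows_le_odot (r2 _).
  - apply: rows_le_sum => k; rewrite mem_index_iota => kn _.
    by apply: rows_le_schur => //; rewrite /is_part /= !inE /n; lia.
  - by apply: rows_le_schur.
split; apply: alt3_var_inj.
- exact: rows_leW (r2 _).
- exact: rows_leW rR.
(* Both sides have at most two rows, so the comparison in three variables splits into one for each
   pair of variables. *)
- apply: etrans (alt3_rows_le2 _ _ _ (r2 _)) _.
  apply: etrans _ (esym (alt3_rows_le2 _ _ _ rR)).
  have comb (a b c p q r p' q' r' : S) : p = p' -> q = q' -> r = r' ->
      a * p - b * q + c * r = a * p' - b * q' + c * r'.
    by move=> -> -> ->.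
  exact: comb (alt2_h3h phi_inj m (nz _) (nz _) sxy)
    (alt2_h3h phi_inj m (nz _) (nz _) sxz)
    (alt2_h3h phi_inj m (nz _) (nz _) syz).
- exact: rows_le_h3h.
- apply: rows_leD; first apply: rows_leD.
  + exact: rows_leW (r2 _).
  + exact: rows_le_odot (rows_le_h3h _).
  + exact: rows_le_odot (rows_leW _ (r2 _)).
- exact: (alt3_h3h phi_inj m (nz _) (nz _) (nz _) sxy sxz syz).
Qed.

End ThreeVariables.

(** * The initial values and the conclusion *)

Lemma plethysm_h3_h0 : plethysm (hsym 3) (hsym 0) = 1.
Proof.
apply: (@scale_natSI _ 5); rewrite scaler_nat plethysm_h3_hsym hsym0 !rmorph1.
by rewrite expr1n mulr1 -mulrS -mulrnDr scaler_nat.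
Qed.

Lemma adams_psum1 r : adams r (hsym 1) = psum r.
Proof.
have := ev_hsymS (fun m => psum (r * m)) 0.
by rewrite big_nat1 scale1r subn0 hsym0 rmorph1 mulr1 muln1.
Qed.

(** Since [h_1 = p_1], plethysm with [h_1] inside sends each [p_k] to itself. *)
Lemma plethysm_h3_h1 : plethysm (hsym 3) (hsym 1) = schur [:: 3%N].
Proof.
rewrite schur1 -[RHS]ev_psum_hsym /plethysm; apply: eq_ev => k _.
exact: adams_psum1.
Qed.

Theorem theorem2p1 :
  plethysm (hsym 3) (hsym 0) = 1 /\
  plethysm (hsym 3) (hsym 1) = schur [:: 3%N] /\
  (forall n : nat, (2 <= n)%N ->
     down 2 (h3h n%:Z) =
       odot (schur [:: 6; 6]%N) (down 2 (h3h (n%:Z - 4)))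
       + \sum_(2 <= k < n.+1) schur [:: (3 * n - k)%N; k]
       + schur [:: (3 * n)%N]
     /\
     h3h n%:Z =
       down 2 (h3h n%:Z)
       + odot (schur [:: 2; 2; 2]%N) (h3h (n%:Z - 2))
       + odot (schur [:: 4; 4; 1]%N) (down 2 (h3h (n%:Z - 3)))).
Proof.
split; first exact: plethysm_h3_h0.
split; first exact: plethysm_h3_h1.
move=> n n2; have [m ->] : exists m, n = m.+2 by exists n.-2; lia.
exact: h3h_rec.
Qed.
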